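(* Let $n>2$, $m\ge2$ and $1\le s\le n-1$. For every cylindric skew shape $D\subset\mathcal{C}_s$ and every $r\in\mathbb{Z}/n\mathbb{Z}$, the quantum cylindric loop Schur function satisfies $s_D^{(r)}(\mathbf{q}_1,\dots,\mathbf{q}_m)\in\mathcal{Q}_\epsilon^{\mathfrak{S}_m}$.
   Context: Second (equivalently, upper) indices are taken in $\mathbb{Z}/n\mathbb{Z}$, $\epsilon$ is a central indeterminate, and we write $q_j^{(i)}=q_{j,i}$. For $k\in\mathbb{Z}/n\mathbb{Z}$ let $S_k$ be the set of $q_{j,i}$ with $i+j\equiv1+k\pmod n$. $\mathcal{Q}_\epsilon=\mathbb{Q}_\epsilon\langle\mathbf{q}_1,\dots,\mathbf{q}_m\rangle$, $\mathbf{q}_j=(q_{j,i})_{i}$, is the skew field of fractions of the quantum torus over $\mathbb{Z}[\epsilon,\epsilon^{-1}]$ generated by the $q_{j,i}^{\pm1}$ ($1\le j\le m$, $i\in\mathbb{Z}/n\mathbb{Z}$) with relations $$q_{j,i}q_{j',i'}=\begin{cases}\epsilon\,q_{j',i'}q_{j,i}&q_{j,i}\in S_{k+1},\ q_{j',i'}\in S_k,\ j\le j',\\ \epsilon^{-1}q_{j',i'}q_{j,i}&q_{j,i}\in S_{k+1},\ q_{j',i'}\in S_k,\ j>j',\\ \epsilon^{-2}q_{j',i'}q_{j,i}&q_{j,i},q_{j',i'}\in S_k,\ j<j',\\ \epsilon^{2}q_{j',i'}q_{j,i}&q_{j,i},q_{j',i'}\in S_k,\ j>j',\\ q_{j',i'}q_{j,i}&\text{if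 neither } (q_{j,i},q_{j',i'}) \text{ nor } (q_{j',i'},q_{j,i}) \text{ is covered by the previous cases.}\end{cases}$$ Quantum geometric $R$-matrix: for $1\le j\le m-1$ write $p_i=q_{j,i}$, $q_i=q_{j+1,i}$, and $$\kappa_i^\epsilon=\sum_{h=0}^{n-1}p_{i-1}p_{i-2}\cdots p_{i-h}\,q_{i-h-2}q_{i-h-3}\cdots q_{i-n}\qquad(\text{factors in this order}).$$ $R_j^\epsilon:\mathcal{Q}_\epsilon\to\mathcal{Q}_\epsilon$ is the morphism of skew fields with $R_j^\epsilon(p_i)=(\kappa_i^\epsilon)^{-1}q_i\,\kappa_{i+1}^\epsilon$, $R_j^\epsilon(q_i)=(\kappa_{i+1}^\epsilon)^{-1}p_i\,\kappa_i^\epsilon$, fixing $\epsilon$ and all $q_{j',i}$ with $j'\ne j,j+1$. The $R_j^\epsilon$ generate an action of $\mathfrak{S}_m$ on $\mathcal{Q}_\epsilon$, and $\mathcal{Q}_\epsilon^{\mathfrak{S}_m}$ denotes the set of elements fixed by all of $R_1^\epsilon,\dots,R_{m-1}^\epsilon$. Cylindric shapes: $\mathcal{C}_s=\mathbb{Z}^2/(n-s,s)\mathbb{Z}$, partially ordered by the transitive closure of the relations $(x,y)<(x+1,y)$ and $(x,y)<(x,y-1)$. A box in row $i$ and column $j$ of a Young diagram (English notation) has coordinates $(j,-i)$. A cylindric skew shape $D$ is a finite convex subposet of $\mathcal{C}_s$. A semistandard Young tableau of shape $D$ is a map $T:D\to\mathbb{Z}_{>0}$ with $T(x,y)\le T(x+1,y)$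 and $T(x,y)<T(x,y-1)$ whenever the boxes involved lie in $D$. View $D$ as an infinite periodic skew shape in $\mathbb{Z}^2$ (its preimage, with $T$ extended periodically), and fix a fundamental domain consisting of $n-s$ consecutive columns, ordered from left to right. For a box $b$ with row $i$ and column $j$ put $c(b)=i-j$ (so $c(b)=-x-y$ for $b=(x,y)$; it is well defined modulo $n$ on $\mathcal{C}_s$). The $r$-reading word of $T$ is $$\mathrm{wt}_\epsilon^{(r)}(T)=\prod_{b\in D}q_{T(b)}^{(c(b)-T(b)+r+1)}\in\mathcal{Q}_\epsilon,$$ the product being taken by reading the columns of the fundamental domain from left to right, each column from top to bottom. Then $$s_D^{(r)}(\mathbf{q}_1,\dots,\mathbf{q}_m)=\sum_T\mathrm{wt}_\epsilon^{(r)}(T),$$ the sum being over all semistandard Young tableaux $T$ of cylindric skew shape $D$ with entries in $\{1,\dots,m\}$. *)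

(* Defs.v *)
From Stdlib Require Import Relation_Operators.
From mathcomp Require Import all_boot all_order all_algebra.
From mathcomp Require Import finmap boolp.

Set Implicit Arguments.
Unset Strict Implicit.
Unset Printing Implicit Defensive.

Import Order.TTheory GRing.Theory Num.Theory.
Local Open Scope ring_scope.

(* An ordinal [j : 'I_m] stands for the index [j.+1] of {1, ..., m}. Second
   indices live in ['Z_n], which is Z/nZ as soon as [1 < n]. *)

Section QuantumTorus.
Variables (m n : nat).

Definition in_S (k : 'Z_n) (a : 'I_m * 'Z_n) : bool :=
  a.2 + a.1.+1%:R == 1 + k.

(* The pair (a, b) falls under one of the four explicit cases of the
   commutation relations. *)
Definition covered (a b : 'I_m * 'Z_n) : bool :=
  [exists k, (in_S (k + 1) a && in_S k b)
             || [&& in_S k a, in_S k b & a.1 != b.1]].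

Record torus_relations (B : unitRingType) (eps : B) (q : 'I_m -> 'Z_n -> B)
    : Prop := TorusRelations {
  tr_eps_unit : eps \is a GRing.unit;
  tr_eps_central : forall x : B, eps * x = x * eps;
  tr_q_unit : forall j i, q j i \is a GRing.unit;
  tr_succ_le : forall k j i j' i', in_S (k + 1) (j, i) -> in_S k (j', i') ->
    (j <= j')%N -> q j i * q j' i' = eps * q j' i' * q j i;
  tr_succ_gt : forall k j i j' i', in_S (k + 1) (j, i) -> in_S k (j', i') ->
    (j' < j)%N -> q j i * q j' i' = eps^-1 * q j' i' * q j i;
  tr_same_lt : forall k j i j' i', in_S k (j, i) -> in_S k (j', i') ->
    (j < j')%N -> q j i * q j' i' = eps ^- 2 * q j' i' * q j i;
  tr_same_gt : forall k j i j' i', in_S k (j, i) -> in_S k (j', i') ->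
    (j' < j)%N -> q j i * q j' i' = eps ^+ 2 * q j' i' * q j i;
  tr_comm : forall j i j' i',
    ~~ covered (j, i) (j', i') -> ~~ covered (j', i') (j, i) ->
    q j i * q j' i' = q j' i' * q j i
}.

(* [A] is the algebra over Z[eps, eps^-1] presented by the generators
   [q j i], their inverses and the above relations, expressed by the universal
   property of such a presentation. *)
Record is_quantum_torus (A : unitRingType) (eps : A) (q : 'I_m -> 'Z_n -> A)
    : Prop := IsQuantumTorus {
  qt_relations : torus_relations eps q;
  qt_exists : forall (B : unitRingType) (eps' : B) (q' : 'I_m -> 'Z_n -> B),
    torus_relations eps' q' ->
    exists f : {rmorphism A -> B},
      f eps = eps' /\ (forall j i, f (q j i) = q' j i);
  qt_unique : forall (B : unitRingType) (f g : {rmorphism A -> B}),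
    f eps = g eps -> (forall j i, f (q j i) = g (q j i)) -> f =1 g
}.

End QuantumTorus.

Record is_skew_field_of_fractions (A Q : unitRingType)
    (iota : {rmorphism A -> Q}) : Prop := IsSkewFieldOfFractions {
  sf_division : forall x : Q, x != 0 -> x \is a GRing.unit;
  sf_injective : injective iota;
  sf_fraction : forall x : Q, exists a b : A, b != 0 /\ x = iota a / iota b
}.

Section RMatrix.
Variables (m n : nat) (Q : unitRingType).

Definition kappa (p q : 'Z_n -> Q) (i : 'Z_n) : Q :=
  \sum_(h < n) (\prod_(1 <= a < h.+1) p (i - a%:R))
               * (\prod_(h.+2 <= a < n.+1) q (i - a%:R)).

(* [j'] is meant to be the successor of [j]. *)
Definition is_R_matrix (eps : Q) (q : 'I_m -> 'Z_n -> Q) (j j' : 'I_m)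
    (R : {rmorphism Q -> Q}) : Prop :=
  let kap := kappa (q j) (q j') in
  [/\ R eps = eps,
      forall i, R (q j i) = (kap i)^-1 * q j' i * kap (i + 1),
      forall i, R (q j' i) = (kap (i + 1))^-1 * q j i * kap i
    & forall l i, l != j -> l != j' -> R (q l i) = q l i].

Definition fixed_by_all (I : Type) (R : I -> {rmorphism Q -> Q}) (x : Q) :=
  forall j, R j x = x.

End RMatrix.

Section CylindricShapes.
Variables (n s : nat).

Definition cyl_period : int * int := (n%:Z - s%:Z, s%:Z).

Definition cyl_rel (u v : int * int) : bool :=
  `[< exists t : int, v - u = cyl_period *~ t >].

Lemma cyl_rel_refl : reflexive cyl_rel.
Proof. by move=> u; apply/asboolP; exists 0; rewrite subrr mulr0z. Qed.

Lemma cyl_rel_sym : symmetric cyl_rel.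
Proof.
move=> u v; apply/asboolP/asboolP => -[t e]; exists (- t);
by rewrite mulrNz -e opprB.
Qed.

Lemma cyl_rel_trans : transitive cyl_rel.
Proof.
move=> v u w /asboolP[t e] /asboolP[t' e']; apply/asboolP; exists (t' + t).
by rewrite mulrzDr -e -e' addrA subrK.
Qed.

Definition cyl_equiv : equiv_rel (int * int) :=
  EquivRel cyl_rel cyl_rel_refl cyl_rel_sym cyl_rel_trans.

Definition cyl := {eq_quot cyl_equiv}%qT.

Definition box (x y : int) : cyl := (\pi_cyl (x, y))%qT.

Definition right_of (b b' : cyl) : Prop :=
  exists x y, b = box x y /\ b' = box (x + 1) y.

Definition below (b b' : cyl) : Prop :=
  exists x y, b = box x y /\ b' = box x (y - 1).

Definition cyl_lt : cyl -> cyl -> Prop :=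
  clos_trans cyl (fun b b' => right_of b b' \/ below b b').

Definition cylindric_skew_shape (D : {fset cyl}) : Prop :=
  forall a b c, a \in D -> b \in D -> cyl_lt a c -> cyl_lt c b -> c \in D.

Definition content (b : cyl) : 'Z_n :=
  let u := repr b in (- u.1 - u.2)%:~R.

(* The preimage of [b] in the columns x0, ..., x0 + (n - s) - 1. *)
Definition rep_in (x0 : int) (b : cyl) : int * int :=
  let u := repr b in
  u - cyl_period *~ ((u.1 - x0) %/ (n%:Z - s%:Z))%Z.

(* Top to bottom in a column is decreasing second coordinate. *)
Definition reads_before (x0 : int) (b b' : cyl) : bool :=
  let u := rep_in x0 b in let v := rep_in x0 b' in
  (u.1 < v.1) || ((u.1 == v.1) && (v.2 <= u.2)).

Section Tableaux.
Variables (m : nat) (D : {fset cyl}).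

Definition semistandard (T : {ffun D -> 'I_m}) : Prop :=
  forall b b' : D,
    (right_of (val b) (val b') -> (T b <= T b')%N) /\
    (below (val b) (val b') -> (T b < T b')%N).

Definition reading_order (x0 : int) : seq D :=
  sort (fun b b' : D => reads_before x0 (val b) (val b')) (enum {: D}).

Definition reading_word (Q : unitRingType) (q : 'I_m -> 'Z_n -> Q)
    (x0 : int) (r : 'Z_n) (T : {ffun D -> 'I_m}) : Q :=
  \prod_(b <- reading_order x0)
     q (T b) (content (val b) - (T b).+1%:R + r + 1).

Definition loop_schur (Q : unitRingType) (q : 'I_m -> 'Z_n -> Q)
    (x0 : int) (r : 'Z_n) : Q :=
  \sum_(T : {ffun D -> 'I_m} | `[< semistandard T >]) reading_word q x0 r T.

End Tableaux.
End CylindricShapes.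

(* Main.v *)
Require Import Defs.
From Stdlib Require Import Relation_Operators.
From mathcomp Require Import all_boot all_order all_algebra.
From mathcomp Require Import finmap boolp zify ring.

(** Write [p], [q] for the two rows [j], [j.+1] exchanged by an R-matrix [R], and
    sort the generators by color, [S_k] being color [k].  The color of the
    letter of a box [b] is its content plus [r], whatever the entry of [b].  The
    power of [eps] with which letters of two distinct rows commute depends only
    on their colors and on which row comes first, so that a letter of a third
    row cannot tell [p_k] from [q_k].

    Two kinds of expressions are fixed by [R]: the dominoes
    [p_k q_(k+1)], where the subscript is a color ([R_domino]), and the sums
    [p_k + q_k] ([R_sum]).  The first statement says that a domino commutes with
    [kappa] up to a power of [eps].  The second one is the identity
      [q_i kappa_(i+1) + p_(i-1) kappa_(i-1) = kappa_i (p_i + q_(i-1))],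
    now with second indices as subscripts, where the terms of the two sides match
    after a shift of the summation index ([kappa_linear]).

    Group the tableaux as for the symmetry of Schur functions: an entry equal to
    [j] or [j.+1] is free unless it belongs to a vertical domino [j] over [j.+1],
    and two tableaux are in the same class if they differ by the entries of
    their free boxes ([key]).  By convexity of the shape, the free boxes of a
    fundamental domain have distinct columns and contents that decrease strictly,
    by less than [n] in total; the values of the free boxes can be chosen at
    will, except that [j.+1] may not stand immediately to the left of [j]
    ([assign_semistandard], [free_chain_ok]).

    In the words of a class, the letters of the boxes that are not free move to
    the left of the free ones at the cost of one and the same power of [eps]: a
    domino meets [p_k] and [q_k] with the same exponent ([misplaced_class]).  They
    form a word in other rows and in dominoes, so [R] fixes it
    ([unfree_word_fixed]).  What remains is the sum over a class of the words of
    the free boxes.  Read from the left, such a sum satisfies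
      [F(c, d, ...) = (p_c + q_c) F(d, ...) - q_c p_d F(...)] if [c = d + 1],
    and [F(c, d, ...) = (p_c + q_c) F(d, ...)] otherwise, so that [R] fixes it
    ([row_sum_fixed]).  If the last free box is the left neighbor, around the
    cylinder, of the first one, the words [p_c ... q_d] have to be left out, and
    their sum is fixed as well because [q_d] moves next to [p_c]
    ([chain_sum_fixed]).  Adding up the classes gives the theorem. *)

Set Implicit Arguments.
Unset Strict Implicit.
Unset Printing Implicit Defensive.

Import Order.TTheory GRing.Theory Num.Theory.
Local Open Scope ring_scope.

(** * Skew-commuting families *)

Section SkewCommutation.
Variables (Q : unitRingType) (eps : Q).
Hypothesis eps_unit : eps \is a GRing.unit.
Hypothesis eps_central : forall x : Q, eps * x = x * eps.

Definition skew_comm (z : int) (u v : Q) := u * v = eps ^ z * (v * u).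

Lemma exp_central z (x : Q) : eps ^ z * x = x * eps ^ z.
Proof. by apply/esym/commrXz/esym/eps_central. Qed.

Lemma skew_commMl z z' u u' v :
  skew_comm z u v -> skew_comm z' u' v -> skew_comm (z + z') (u * u') v.
Proof.
rewrite /skew_comm => e e'.
rewrite -(mulrA u) e' (mulrA u) -exp_central -(mulrA _ u) (mulrA u v) e.
by rewrite -(mulrA _ (v * u)) (mulrA (eps ^ z')) -exprzDr // -(mulrA v) [z' + z]addrC.
Qed.

Lemma skew_comm_sym z u v : skew_comm z u v -> skew_comm (- z) v u.
Proof. by rewrite /skew_comm => ->; rewrite mulrA -exprzDr // addNr mul1r. Qed.

Lemma skew_commMr z z' u v v' :
  skew_comm z u v -> skew_comm z' u v' -> skew_comm (z + z') u (v * v').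
Proof.
move=> /skew_comm_sym e /skew_comm_sym e'.
by rewrite -[z + z']opprK opprD; apply/skew_comm_sym/skew_commMl.
Qed.

Lemma skew_comm1r u : skew_comm 0 u 1.
Proof. by rewrite /skew_comm expr0z !mul1r mulr1. Qed.

Lemma skew_comm_prod (I : eqType) (l : seq I) (F : I -> Q) (z : I -> int) u :
  {in l, forall a, skew_comm (z a) u (F a)} ->
  skew_comm (\sum_(a <- l) z a) u (\prod_(a <- l) F a).
Proof.
elim: l => [|a l ih] h; first by rewrite !big_nil; apply: skew_comm1r.
rewrite !big_cons; apply: skew_commMr; first by apply: h; rewrite mem_head.
by apply: ih => b b_l; apply: h; rewrite inE b_l orbT.
Qed.

Lemma skew_comm_sum (I : eqType) (l : seq I) (P : pred I) (F : I -> Q) z u :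
  {in l, forall a, P a -> skew_comm z u (F a)} ->
  skew_comm z u (\sum_(a <- l | P a) F a).
Proof.
move=> h; rewrite /skew_comm mulr_suml mulr_sumr mulr_sumr big_seq_cond.
rewrite [RHS]big_seq_cond; apply: eq_bigr => a /andP[a_l Pa].
exact: h.
Qed.

(** Moving the letters in [p] to the end costs one commutation for each pair
    that is out of order.  These pairs are singled out by [lt] rather than by
    positions, which makes the exponents of two words easy to compare. *)
Lemma prod_split (I : eqType) (lt : rel I) (F : I -> Q) (om : I -> I -> int)
    (p : pred I) (l : seq I) :
  (forall a b, skew_comm (om a b) (F a) (F b)) ->
  pairwise (fun a b => lt a b && ~~ lt b a) l ->
  \prod_(a <- l) F a =
    eps ^ (\sum_(a <- l | p a) \sum_(b <- l | ~~ p b && lt a b) om a b) *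
    ((\prod_(a <- l | ~~ p a) F a) * \prod_(a <- l | p a) F a).
Proof.
move=> hom; elim: l => [|a l ih]; first by rewrite !big_nil expr0z !mul1r.
rewrite pairwise_cons => /andP[/allP ha /ih {}ih]; rewrite !big_cons {}ih.
have drop : \sum_(x <- l | p x) \sum_(b <- a :: l | ~~ p b && lt x b) om x b =
            \sum_(x <- l | p x) \sum_(b <- l | ~~ p b && lt x b) om x b.
  rewrite big_seq_cond [RHS]big_seq_cond.
  apply: eq_bigr => x /andP[/ha /andP[_ /negPf nxa] _].
  by rewrite big_cons nxa andbF.
case: (boolP (p a)) => pa /=; rewrite drop /=; last first.
  by rewrite -!mulrA mulrA -exp_central -!mulrA.
have -> : \sum_(b <- l | ~~ p b && lt a b) om a b =
          \sum_(b <- l | ~~ p b) om a b.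
  rewrite big_seq_cond [RHS]big_seq_cond.
  by apply: eq_bigl => b; case b_l: (b \in l); rewrite //= andbC; case/andP: (ha b b_l) => ->.
have e : skew_comm (\sum_(b <- l | ~~ p b) om a b) (F a)
           (\prod_(b <- l | ~~ p b) F b).
  by rewrite -!(big_filter l); apply: skew_comm_prod => b _; apply: hom.
rewrite [in RHS]addrC exprzDr // -!mulrA mulrA -exp_central -!mulrA.
by congr (_ * _); rewrite !mulrA e -!mulrA.
Qed.

(** The value of the exponent is left out: a map that fixes [eps] fixes one of
    the two products as soon as it fixes the other, whatever the exponent. *)
Lemma prod_perm (I : eqType) (F : I -> Q) (om : I -> I -> int) (l l' : seq I) :
  (forall a b, skew_comm (om a b) (F a) (F b)) -> perm_eq l l' ->
  exists z, \prod_(a <- l) F a = eps ^ z * \prod_(a <- l') F a.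
Proof.
move=> hom; elim: l l' => [|a l ih] l' e.
  by exists 0; move: e; rewrite perm_sym => /perm_nilP ->; rewrite mul1r.
have a_l' : a \in l' by rewrite -(perm_mem e) mem_head.
case/splitPr: a_l' e => l1 l2; rewrite perm_sym -[a :: l2]cat1s perm_catCA /= perm_cons.
rewrite perm_sym => /ih[z zE].
have c : skew_comm (\sum_(b <- l1) om a b) (F a) (\prod_(b <- l1) F b).
  by apply: skew_comm_prod => b _; apply: hom.
exists (z + \sum_(b <- l1) om a b).
rewrite big_cons zE big_cat big_cat big_cons /= exprzDr // mulrA -exp_central.
by rewrite -!mulrA; congr (_ * _); rewrite !mulrA c -!mulrA.
Qed.
End SkewCommutation.

(** * Colors and commutation exponents *)

Section Residues.
Variable n : nat.
Hypothesis hn : (2 < n)%N.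

Lemma Zn_natr_eq0 (a : nat) : (a%:R == 0 :> 'Z_n) = (n %| a)%N.
Proof.
have n_gt1 : (1 < n)%N by lia.
by rewrite -val_eqE /= val_Zp_nat.
Qed.

Lemma Zn_natr0 : n%:R = 0 :> 'Z_n.
Proof. by apply/eqP; rewrite Zn_natr_eq0. Qed.

Lemma Zn_neqS (k : 'Z_n) : (k == k + 1) = false.
Proof.
rewrite -{1}[k]addr0 (can_eq (addKr k)) eq_sym.
by rewrite -[1]/(1%:R) Zn_natr_eq0 dvdn1; lia.
Qed.

Lemma Zn_neqSS (k : 'Z_n) : (k == k + 1 + 1) = false.
Proof.
rewrite -{1}[k]addr0 -addrA (can_eq (addKr k)) eq_sym -[1 + 1]/(2%:R) Zn_natr_eq0.
by apply/negP => /dvdn_leq; lia.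
Qed.

End Residues.

Section CommutationExponents.
Variables m n : nat.

(** A letter is a row and a color [k], the index of the set [S_k] containing
    the generator.  The relations depend on the second index of a generator
    through its color alone, and the color of a box of a tableau depends on
    the content of the box but not on its entry. *)
Definition letter := ('I_m * 'Z_n)%type.

Definition comm_sign (b : bool) : int := if b then 1 else -1.

Definition comm_exp (a b : letter) : int :=
  (a.2 == b.2 + 1)%:Z * comm_sign (a.1 <= b.1)%N
  - (b.2 == a.2 + 1)%:Z * comm_sign (b.1 <= a.1)%N
  + (a.2 == b.2)%:Z * (2 * ((b.1 < a.1)%N%:Z - (a.1 < b.1)%N%:Z)).

(** This is the exponent with which a vertical domino, with [j] of color [k]
    above [j.+1] of color [k + 1], commutes with a letter of color [c] in one of
    these two rows, whichever it is. *)
Definition domino_exp (k c : 'Z_n) : int :=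
  (c == k + 1)%:Z + (k == c + 1)%:Z - (c == k + 1 + 1)%:Z - (c == k)%:Z.

Lemma domino_exp_shift (k : 'Z_n) t : (2 < n)%N -> (0 < t < n)%N ->
  domino_exp k (k - t%:R) = (t == 1)%N%:Z + (t == n.-1)%N%:Z - (t == n.-2)%N%:Z.
Proof.
move=> hn t_n; rewrite /domino_exp.
have eqE a : (a < 3)%N -> (k - t%:R == k + a%:R) = (t + a == n)%N.
  move=> a3; rewrite eq_sym -subr_eq0 (_ : _ - _ = (t + a)%:R); last by rewrite natrD; ring.
  rewrite Zn_natr_eq0 //; apply/idP/eqP => [|->//].
  by case/dvdnP=> -[|[|c]] /=; nia.
rewrite (_ : k + 1 + 1 = k + 2%:R); last by ring.
rewrite (_ : (k - t%:R == k) = (k - t%:R == k + 0%:R)); last by rewrite addr0.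
rewrite (_ : (k == k - t%:R + 1) = (t == 1%N)); last first.
  rewrite eq_sym -subr_eq0 (_ : _ - k = - (t.-1)%:R); last first.
    by case: t t_n eqE => // t _ _; rewrite -natr1; ring.
  rewrite oppr_eq0 Zn_natr_eq0 //; apply/idP/eqP => [|->//].
  by case/dvdnP=> -[|c] /=; nia.
rewrite (_ : k + 1 = k + 1%:R) // !eqE //; lia.
Qed.

Lemma sum_domino_exp (k : 'Z_n) a b : (2 < n)%N -> (0 < a <= b)%N -> (b <= n)%N ->
  \sum_(a <= t < b) domino_exp k (k - t%:R) =
  (a <= 1 < b)%N%:Z + (a <= n.-1 < b)%N%:Z - (a <= n.-2 < b)%N%:Z.
Proof.
move=> hn /andP[a0 /subnKC <-]; elim: (b - a)%N => [|d ih] bn.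
  by rewrite addn0 big_geq // ; lia.
rewrite addnS big_nat_recr ?leq_addr //= ih ?domino_exp_shift; lia.
Qed.

Section AdjacentRows.
Variables (j j' : 'I_m).
Hypothesis jj' : j' = j.+1 :> nat.

Lemma comm_exp_domino (k : 'Z_n) (a : letter) :
  (a.1 == j) || (a.1 == j') ->
  comm_exp a (j, k) + comm_exp a (j', k + 1) = - domino_exp k a.2.
Proof.
case: a => l c /= /pred2P l_jj'.
rewrite /comm_exp /domino_exp /comm_sign /= (can_eq (addrK 1)) [k == c]eq_sym.
by case: l_jj' => ->; rewrite jj' ?leqnn ?leqnSn ?ltnn ?ltnSn ?ltnS /=; lia.
Qed.

End AdjacentRows.
End CommutationExponents.

Section QuantumTorusRelations.
Variables (m n : nat) (Q : unitRingType) (eps : Q) (q : 'I_m -> 'Z_n -> Q).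
Hypothesis hn : (2 < n)%N.
Hypothesis rel_q : torus_relations eps q.

Let eps_unit := tr_eps_unit rel_q.
Let eps_central := tr_eps_central rel_q.

Definition gen (a : letter m n) : Q := q a.1 (a.2 - a.1.+1%:R + 1).

Lemma in_S_gen (k : 'Z_n) (a : letter m n) :
  in_S k (a.1, a.2 - a.1.+1%:R + 1) = (a.2 == k).
Proof.
rewrite /in_S /=.
by rewrite addrAC subrK addrC (can_eq (addKr 1)).
Qed.

Lemma gen_comm (a b : letter m n) : skew_comm eps (comm_exp a b) (gen a) (gen b).
Proof.
case: a b => [j k] [j' k']; rewrite /skew_comm /comm_exp /gen /=.
have iS := in_S_gen.
have [->|k_ne] := eqVneq k (k' + 1).
  rewrite (negbTE _ : (k' == k' + 1 + 1) = false) ?Zn_neqSS //.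
  rewrite [k' + 1 == k']eq_sym Zn_neqS // !mul0r subr0 addr0 mul1r.
  case: (leqP j j') => [le|lt].
    rewrite /comm_sign expr1z mulrA.
    by apply: (tr_succ_le rel_q (k := k')); rewrite ?(iS _ (_, _)).
  rewrite /comm_sign mulrA.
  by apply: (tr_succ_gt rel_q (k := k')); rewrite ?(iS _ (_, _)).
have [->|k'_ne] := eqVneq k' (k + 1).
  rewrite Zn_neqS // !mul0r add0r addr0 mul1r.
  case: (leqP j' j) => [le|lt].
    rewrite (tr_succ_le rel_q (k := k) (j := j') (j' := j)) ?(iS _ (_, _)) //.
    by rewrite /comm_sign -!mulrA mulKr.
  rewrite (tr_succ_gt rel_q (k := k) (j := j') (j' := j)) ?(iS _ (_, _)) //.
  by rewrite /comm_sign opprK expr1z -!mulrA mulVKr.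
have [<-|kk'] := eqVneq k k'.
  rewrite !mul0r subr0 add0r mul1r mulrA.
  case: (ltngtP j j') => [lt|lt|/val_inj <-].
  - by apply: (tr_same_lt rel_q (k := k)); rewrite ?(iS _ (_, _)).
  - by apply: (tr_same_gt rel_q (k := k)); rewrite ?(iS _ (_, _)).
  - by rewrite subrr mulr0 expr0z mul1r.
rewrite !mul0r subr0 add0r expr0z mul1r; apply: (tr_comm rel_q);
  apply/negP => /existsP[c]; rewrite !(iS _ (_, _)) /=;
  case/orP=> [/andP[/eqP kE /eqP k'E]|/and3P[/eqP kE /eqP k'E _]].
- by case/eqP: k_ne; rewrite kE k'E.
- by case/eqP: kk'; rewrite kE k'E.
- by case/eqP: k'_ne; rewrite kE k'E.
- by case/eqP: kk'; rewrite kE k'E.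
Qed.

Variables (j j' : 'I_m).
Hypothesis jj' : j' = j.+1 :> nat.

Lemma domino_comm (k : 'Z_n) (a : letter m n) :
  (a.1 == j) || (a.1 == j') ->
  skew_comm eps (domino_exp k a.2) (gen (j', k + 1) * gen (j, k)) (gen a).
Proof.
move=> /(comm_exp_domino jj' k) e; rewrite -[domino_exp _ _]opprK -e addrC.
apply: skew_comm_sym => //; apply: skew_commMr => //; exact: gen_comm.
Qed.

End QuantumTorusRelations.

(** * Elements fixed by the quantum R-matrix *)

Lemma sum_nat_last (V : nmodType) (F : nat -> V) N : (0 < N)%N ->
  \sum_(0 <= h < N) F h = \sum_(0 <= h < N.-1) F h + F N.-1.
Proof. by case: N => // N _; rewrite big_nat_recr. Qed.

Section RMatrixInvariants.
Variables (m n : nat) (Q : unitRingType) (eps : Q) (q : 'I_m -> 'Z_n -> Q).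
Hypothesis hn : (2 < n)%N.
Hypothesis rel_q : torus_relations eps q.
Variables (j j' : 'I_m).
Hypothesis jj' : j' = j.+1 :> nat.

Let eps_unit := tr_eps_unit rel_q.
Let eps_central := tr_eps_central rel_q.
Let kap := kappa (q j) (q j').

Lemma genE (l : 'I_m) i : q l i = gen q (l, i + l%:R).
Proof. by rewrite /gen /=; congr (q _ _); ring. Qed.

Lemma gen_upper i t : q j (i - t%:R) = gen q (j, i + j%:R - t%:R).
Proof. by rewrite genE addrAC. Qed.

Lemma gen_lower i t : q j' (i - t.+1%:R) = gen q (j', i + j%:R - t%:R).
Proof. by rewrite genE jj'; congr (gen q (_, _)); ring. Qed.

Lemma gen_lower0 i : q j' i = gen q (j', i + j%:R + 1).
Proof. by rewrite genE jj'; congr (gen q (_, _)); ring. Qed.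

Let dom (i : 'Z_n) := q j' i * q j i.

Lemma domino_comm_run (i : 'Z_n) a b c : (0 < a <= b)%N -> (b <= c <= n)%N ->
  skew_comm eps
    (\sum_(a <= t < c) domino_exp (i + j%:R) (i + j%:R - t%:R))
    (dom i) ((\prod_(a <= t < b) q j (i - t%:R)) *
             \prod_(b.+1 <= t < c.+1) q j' (i - t%:R)).
Proof.
case/andP=> a0 ab /andP[bc cn].
rewrite (big_cat_nat _ bc) //=; apply: skew_commMr => //.
  apply: skew_comm_prod => // t _; rewrite gen_upper /dom gen_lower0 genE.
  by apply: (domino_comm hn rel_q jj' _ (a := (j, _))); rewrite eqxx.
rewrite big_add1 /=; apply: skew_comm_prod => // t _.
rewrite gen_lower /dom gen_lower0 genE.
by apply: (domino_comm hn rel_q jj' _ (a := (j', _))); rewrite eqxx orbT.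
Qed.

(** Each term of [kap i] has one letter of every color but that of [q j i], and
    the exponents of the domino on these colors add up to [1]. *)
Lemma domino_kappa i : skew_comm eps 1 (dom i) (kap i).
Proof.
apply: skew_comm_sum => //= h _ _.
have <- : \sum_(1 <= t < n) domino_exp (i + j%:R) (i + j%:R - t%:R) = 1.
  by rewrite sum_domino_exp; lia.
by apply: domino_comm_run; have := ltn_ord h; lia.
Qed.

(** The letter that moves around has two neighbors in color among the others,
    with opposite exponents. *)
Lemma lower_cycle i :
  \prod_(0 <= t < n) q j' (i - t%:R) = \prod_(1 <= t < n.+1) q j' (i - t%:R).
Proof.
rewrite big_ltn; last by lia.
rewrite big_nat_recr /=; last by lia.
rewrite subr0 Zn_natr0 // subr0.
have e : skew_comm eps (\sum_(1 <= t < n) ((t == 1%N)%:Z - (t == n.-1)%:Z))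
           (q j' i) (\prod_(1 <= t < n) q j' (i - t%:R)).
  apply: skew_comm_prod => // t; rewrite mem_index_iota => t_n.
  rewrite genE (genE _ (i - _)).
  rewrite (_ : _ - _ = comm_exp (j', i + j'%:R) (j', i - t%:R + j'%:R)).
    exact: gen_comm.
  rewrite /comm_exp /= leqnn ltnn subrr !mulr0 addr0 !mulr1.
  have -> : (i + j'%:R == i - t%:R + j'%:R + 1) = (t == 1%N).
    rewrite -subr_eq0 [X in X == 0](_ : _ = (t.-1)%:R); last first.
      by case: t t_n => // t _; rewrite -natr1; ring.
    rewrite Zn_natr_eq0 //; apply/idP/eqP => [|->//].
    by case/dvdnP=> -[|c] /=; nia.
  have -> // : (i - t%:R + j'%:R == i + j'%:R + 1) = (t == n.-1).
  rewrite eq_sym -subr_eq0 [X in X == 0](_ : _ = (t + 1)%:R); last by rewrite natrD; ring.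
  rewrite Zn_natr_eq0 //; apply/idP/eqP => [|->//].
    by case/dvdnP=> -[|[|c]] /=; nia.
  by apply/dvdnP; exists 1%N; lia.
have : \sum_(1 <= t < n) ((t == 1%N)%:Z - (t == n.-1)%:Z) = 0.
  have : (1 <= n)%N by lia.
  have sumE b : (1 <= b <= n)%N ->
    \sum_(1 <= t < b) ((t == 1%N)%:Z - (t == n.-1)%:Z) = (1 < b)%N%:Z - (n.-1 < b)%N%:Z.
    elim: b => // -[|b] ih bn; first by rewrite big_geq //; lia.
    by rewrite big_nat_recr //= ih; lia.
  by move=> _; rewrite sumE; lia.
by move=> s0; rewrite e s0 mul1r.
Qed.

(** On the left, the terms are those on the right with the summation index
    moved by one, except for two words in the letters of row [j'], which are
    compared with the help of [lower_cycle]. *)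
Lemma kappa_linear i :
  q j' i * kap (i + 1) + q j (i - 1) * kap (i - 1) =
  kap i * (q j i + q j' (i - 1)).
Proof.
(* [G] collects the words common to the products with [q j' (i - 1)] and with
   [q j (i - 1)], and [W h] is what the domino crosses between the other two. *)
pose P h := \prod_(1 <= t < h.+1) q j (i - t%:R).
pose G h := P h * \prod_(h.+2 <= t < n.+2) q j' (i - t%:R).
pose W h := P h * \prod_(h.+2 <= t < n) q j' (i - t%:R).
have n_gt0 : (0 < n)%N by lia.
have kapE c : kap c = \sum_(0 <= h < n)
    (\prod_(1 <= a < h.+1) q j (c - a%:R)) *
    (\prod_(h.+2 <= a < n.+1) q j' (c - a%:R)) by rewrite big_mkord.
have lower : kap i * q j' (i - 1) = \sum_(0 <= h < n) G h.
  rewrite kapE mulr_suml; apply: eq_big_nat => h /andP[_ hn1].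
  rewrite -mulrA /G; congr (_ * _).
  rewrite [in RHS]big_nat_recr /=; last by lia.
  by congr (_ * q j' _); rewrite -(natr1 n) Zn_natr0 // add0r.
have upper : q j (i - 1) * kap (i - 1) = \sum_(0 <= h < n) G h.+1.
  rewrite kapE mulr_sumr; apply: eq_bigr => h _.
  rewrite mulrA /G /P; congr (_ * _).
    rewrite [in RHS]big_ltn // [in RHS]big_add1 /=; congr (_ * _).
    by apply: eq_bigr => t _; congr (q j _); ring.
  rewrite [in RHS]big_add1 /=.
  by apply: eq_bigr => t _; congr (q j' _); ring.
have dom_W h : (h < n.-1)%N -> dom i * W h = W h * dom i.
  move=> hn1.
  suff e : skew_comm eps 0 (dom i) (W h) by rewrite e mul1r.
  have <- : \sum_(1 <= t < n.-1) domino_exp (i + j%:R) (i + j%:R - t%:R) = 0.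
    by rewrite sum_domino_exp; lia.
  have := @domino_comm_run i 1 h.+1 n.-1; rewrite prednK //; apply; lia.
have left : q j' i * kap (i + 1) =
    \prod_(0 <= t < n) q j' (i - t%:R) + \sum_(0 <= h < n.-1) dom i * W h.
  rewrite kapE mulr_sumr [LHS]big_ltn //; congr (_ + _); last rewrite [LHS]big_add1.
    rewrite big_geq // mul1r [in RHS]big_ltn // subr0; congr (_ * _).
    rewrite [in LHS]big_add1 /=.
    by apply: eq_bigr => t _; congr (q j' _); ring.
  apply: eq_bigr => h _; rewrite /W /P !mulrA; congr (_ * _).
    rewrite -!mulrA; congr (_ * _).
    rewrite [in LHS]big_ltn // [in LHS]big_add1 /=.
    congr (_ * _); first by congr (q j _); ring.
    by apply: eq_bigr => t _; congr (q j _); ring.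
  rewrite [in LHS]big_add1 /=.
  by apply: eq_bigr => t _; congr (q j' _); ring.
have prod_last (F : nat -> Q) a : (a <= n)%N ->
    \prod_(a <= t < n.+1) F t = (\prod_(a <= t < n) F t) * F n.
  by move=> an; rewrite big_nat_recr //; lia.
have right : kap i * q j i = \sum_(0 <= h < n.-1) W h * dom i + P n.
  rewrite kapE mulr_suml sum_nat_last //; congr (_ + _).
    apply: eq_big_nat => h /andP[_ hn1].
    rewrite /W /dom -!mulrA; congr (_ * _).
    by rewrite prod_last ?Zn_natr0 // ?subr0 -?mulrA //; lia.
  rewrite [X in _ * X * _]big_geq ?prednK // mulr1 /P prod_last; last by lia.
  by rewrite Zn_natr0 // subr0.
rewrite mulrDr left upper lower right.
have -> : \sum_(0 <= h < n.-1) dom i * W h = \sum_(0 <= h < n.-1) W h * dom i.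
  by apply: eq_big_nat => h /andP[_]; apply: dom_W.
have e : \prod_(0 <= t < n) q j' (i - t%:R) + \sum_(0 <= h < n) G h.+1 =
         \sum_(0 <= h < n) G h + P n.
  have <- : G n = P n by rewrite /G big_geq ?mulr1.
  rewrite -(@big_nat_recr _ _ _ n 0 G) // big_nat_recl //; congr (_ + _).
  rewrite /G /P [X in _ = X * _]big_geq // mul1r lower_cycle.
  have shift t : q j' (i - t.+1%:R) = q j' (i - 1 - t%:R).
    by congr (q j' _); ring.
  rewrite big_add1 [RHS]big_add1 /=.
  under eq_bigr => t _ do rewrite shift.
  under [RHS]eq_bigr => t _ do rewrite shift.
  exact: lower_cycle.
by rewrite addrAC e [LHS]addrC -[RHS]addrA; congr (_ + _); rewrite addrC.
Qed.

Hypothesis division : forall x : Q, x != 0 -> x \is a GRing.unit.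
Variable R : {rmorphism Q -> Q}.
Hypothesis hR : is_R_matrix eps q j j' R.

(** If [kap i] were zero, so would be its inverse and the image of a unit. *)
Lemma kappa_unit i : kap i \is a GRing.unit.
Proof.
case: hR => _ hp _ _; apply: division; apply/eqP => k0.
have := rmorph_unit R (tr_q_unit rel_q j i).
by rewrite hp -/kap k0 invr0 !mul0r unitr0.
Qed.

Lemma R_exp z : R (eps ^ z) = eps ^ z.
Proof. by case: hR => Re _ _ _; rewrite rmorphXz ?Re. Qed.

Lemma R_other l k : l != j -> l != j' -> R (gen q (l, k)) = gen q (l, k).
Proof. by case: hR => _ _ _ h lj lj'; apply: h. Qed.

Lemma upperE k : gen q (j, k) = q j (k - j%:R).
Proof. by rewrite genE subrK. Qed.

Lemma lowerE k : gen q (j', k) = q j' (k - j%:R - 1).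
Proof. by rewrite genE jj'; congr (gen q (_, _)); ring. Qed.

Lemma R_sum k : R (gen q (j, k) + gen q (j', k)) = gen q (j, k) + gen q (j', k).
Proof.
case: hR => _ hp hq _; rewrite rmorphD upperE lowerE hp hq -!/kap subrK -!mulrA.
by rewrite -mulrDr kappa_linear mulKr ?kappa_unit.
Qed.

Lemma domino_swap k :
  gen q (j, k) * gen q (j', k + 1) =
  eps ^ 1 * (gen q (j', k + 1) * gen q (j, k)).
Proof.
rewrite (gen_comm hn rel_q) /comm_exp /= Zn_neqSS // eqxx [k == _]Zn_neqS // jj'.
by rewrite ltnn !mul0r mul1r sub0r addr0 opprK.
Qed.

(** The image is the conjugate by [kap] of the domino read in the opposite
    order; the powers of [eps] from the conjugation and from the order agree. *)
Lemma R_domino k :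
  R (gen q (j, k) * gen q (j', k + 1)) = gen q (j, k) * gen q (j', k + 1).
Proof.
have sw := domino_swap k; rewrite [in RHS]sw; move: sw.
rewrite upperE lowerE addrAC addrK; set i := k - j%:R => sw.
case: hR => _ hp hq _; rewrite rmorphM hp hq -!/kap.
rewrite !mulrA mulrK ?kappa_unit // -(mulrA _ _ (q j i)) -(mulrA _ _ (kap i)).
by rewrite domino_kappa /dom !mulrA -exp_central // -!mulrA mulKr ?kappa_unit.
Qed.

Lemma R_domino_swap k :
  R (gen q (j', k + 1) * gen q (j, k)) = gen q (j', k + 1) * gen q (j, k).
Proof.
have e : gen q (j', k + 1) * gen q (j, k) =
         eps ^ (-1) * (gen q (j, k) * gen q (j', k + 1)).
  by rewrite domino_swap mulrA -exprzDr // addNr mul1r.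
by rewrite e rmorphM R_exp R_domino.
Qed.
End RMatrixInvariants.

(** * Sums over two-letter words along a chain of contents *)

Fixpoint bitseqs t : seq bitseq :=
  if t is t'.+1 then
    [seq false :: s | s <- bitseqs t'] ++ [seq true :: s | s <- bitseqs t']
  else [:: [::]].

Lemma mem_bitseqs t s : (s \in bitseqs t) = (size s == t).
Proof.
elim: t s => [|t ih] [|e s] //=; rewrite mem_cat.
  by apply/negP => /orP[] /mapP[].
have inj b : injective (cons b : bitseq -> bitseq) by move=> u v [].
case: e; rewrite ?(mem_map (@inj _)) ih ?orbF ?eqSS.
  by rewrite orb_idl // => /mapP[].
by rewrite orb_idr // => /mapP[].
Qed.

Lemma uniq_bitseqs t : uniq (bitseqs t).
Proof.
have inj b : injective (cons b : bitseq -> bitseq) by move=> u v [].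
elim: t => //= t ih; rewrite cat_uniq !map_inj_uniq // ih !andbT /=.
by apply/hasPn => s /mapP[u _ ->]; apply/negP => /mapP[].
Qed.

Section Chains.
Variables (Q : unitRingType) (eps : Q) (n : nat).
Hypothesis eps_unit : eps \is a GRing.unit.
Hypothesis eps_central : forall x : Q, eps * x = x * eps.
Hypothesis hn : (2 < n)%N.
Variable Y : int -> bool -> Q.

Definition chain_word (w : seq (int * bool)) := \prod_(x <- w) Y x.1 x.2.

Definition row_ok (x y : int * bool) := ~~ [&& x.1 == y.1 + 1, x.2 & ~~ y.2].

(** The same condition around the cylinder: content [c + 1 - n] is one turn
    after [c + 1], that is, possibly the left neighbor of the box of content
    [c]. *)
Definition wrap_ok (x y : int * bool) :=
  ~~ [&& y.1 == x.1 + 1 - n%:Z, y.2 & ~~ x.2].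

Definition chain_ok (x y : int * bool) := row_ok x y && wrap_ok x y.

Definition chain_sum (ok : rel (int * bool)) (cs : seq int) : Q :=
  \sum_(s <- bitseqs (size cs) | pairwise ok (zip cs s)) chain_word (zip cs s).

Definition head_sum e c (cs : seq int) : Q :=
  \sum_(s <- bitseqs (size cs) | pairwise row_ok ((c, e) :: zip cs s))
    chain_word (zip cs s).

Lemma chain_sum_cons c cs :
  chain_sum row_ok (c :: cs) =
  Y c false * head_sum false c cs + Y c true * head_sum true c cs.
Proof.
rewrite /chain_sum big_cat !big_map !mulr_sumr.
by congr (_ + _); apply: eq_bigr => s _; rewrite /chain_word big_cons.
Qed.

Lemma head_sum_false c cs : head_sum false c cs = chain_sum row_ok cs.
Proof.
apply: eq_bigl => s; rewrite pairwise_cons.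
by rewrite (@eq_all _ _ predT) ?all_predT // => y; rewrite /row_ok /= andbF.
Qed.

(** As contents decrease strictly, only the next one can be adjacent to [c]. *)
Lemma head_sum_true c d cs : pairwise (fun x y : int => y < x) [:: c, d & cs] ->
  head_sum true c (d :: cs) =
  if c == d + 1 then Y d true * head_sum true d cs
  else chain_sum row_ok (d :: cs).
Proof.
rewrite pairwise_cons /= => /andP[/andP[dc _] /andP[/allP cs_d _]].
have rest e s : all (row_ok (c, e)) (zip cs s).
  apply/allP => -[y f] /(map_f (@fst _ _)) /= y_in.
  have y_cs : y \in cs.
    elim: cs s y_in {cs_d} => [|x cs ih] [|b s] //=.
    by rewrite !inE => /orP[->|/ih ->]; rewrite ?orbT.
  by have := cs_d _ y_cs; rewrite /row_ok /= ; lia.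
have step f :
    \sum_(s <- bitseqs (size cs) | pairwise row_ok ((c, true) :: zip (d :: cs) (f :: s)))
      chain_word (zip (d :: cs) (f :: s)) =
    if row_ok (c, true) (d, f) then Y d f * head_sum f d cs else 0.
  have okE s : pairwise row_ok ((c, true) :: zip (d :: cs) (f :: s)) =
      row_ok (c, true) (d, f) && pairwise row_ok ((d, f) :: zip cs s).
    by rewrite /= rest andbT.
  under eq_bigl => s do rewrite okE.
  case: row_ok; last by rewrite big_pred0.
  by rewrite mulr_sumr; apply: eq_bigr => s _; rewrite /chain_word /= big_cons.
rewrite chain_sum_cons [LHS]/head_sum big_cat !big_map !step /row_ok /= andbF andbT.
by case: (c == d + 1); rewrite ?add0r.
Qed.

Variable R : {rmorphism Q -> Q}.
Hypothesis R_exp : forall z, R (eps ^ z) = eps ^ z.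
Hypothesis R_letter_sum : forall c,
  R (Y c false + Y c true) = Y c false + Y c true.
Hypothesis R_descent : forall c,
  R (Y (c + 1) true * Y c false) = Y (c + 1) true * Y c false.

(** The admissible words on [c :: d :: cs] are all products of a letter at
    [c] with an admissible word on [d :: cs], minus, if [d] is next to [c], those
    with a descent at the front; a descent puts no condition on what follows.
    So the sum is a polynomial in the one-letter sums and the descents. *)
Lemma row_sum_fixed cs : pairwise (fun x y : int => y < x) cs ->
  R (chain_sum row_ok cs) = chain_sum row_ok cs.
Proof.
move: {2}(size cs) (leqnn (size cs)) => N.
elim: N cs => [|N ih] [|c [|d cs]] //=; rewrite ?ltnS => sz dec.
- by rewrite /chain_sum big_cons big_nil /= /chain_word big_nil addr0 rmorph1.
- by rewrite /chain_sum big_cons big_nil /= /chain_word big_nil addr0 rmorph1.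
- rewrite chain_sum_cons /head_sum !big_cons !big_nil /= /chain_word !big_nil.
  rewrite !addr0 !mulr1.
  exact: R_letter_sum.
have dec' : pairwise (fun x y : int => y < x) (d :: cs) by case/andP: dec.
have dec'' : pairwise (fun x y : int => y < x) cs by case/andP: dec'.
have fix1 := ih (d :: cs) sz dec'.
have fix2 := ih cs (ltnW sz) dec''.
rewrite chain_sum_cons head_sum_false head_sum_true //; case: eqP => [cd|_].
  have -> : Y d true * head_sum true d cs =
      chain_sum row_ok (d :: cs) - Y d false * chain_sum row_ok cs.
    by rewrite chain_sum_cons head_sum_false addrAC subrr add0r.
  rewrite mulrBr addrA -mulrDl mulrA cd rmorphB !rmorphM fix1 fix2.
  by rewrite R_letter_sum -rmorphM R_descent.
by rewrite -mulrDl rmorphM R_letter_sum fix1.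
Qed.

Variable comm : int -> int -> int.
Hypothesis wrap_comm : forall d x e, d < x < d + n%:Z - 1 ->
  skew_comm eps (comm d x) (Y d true) (Y x e).
Hypothesis R_wrap : forall d,
  R (Y (d + n%:Z - 1) false * Y d true) = Y (d + n%:Z - 1) false * Y d true.

Lemma bitseqs_rcons t (G : bitseq -> Q) :
  \sum_(s <- bitseqs t.+1) G s =
  \sum_(s <- bitseqs t) (G (rcons s false) + G (rcons s true)).
Proof.
elim: t G => [|t ih] G; first by rewrite /= !big_cons !big_nil !addr0.
rewrite [LHS]big_cat !big_map !(ih (fun s => G (_ :: s))).
by rewrite [RHS]big_cat !big_map.
Qed.

Lemma all_zip_fst (P : pred int) (cs : seq int) (s : bitseq) :
  all P cs -> all (fun x => P x.1) (zip cs s).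
Proof. by elim: cs s => [|c cs ih] [|e s] //= /andP[-> /ih ->]. Qed.

(** Contents spread over less than [n], hence only the two extreme ones can be
    adjacent around the cylinder. *)
Lemma wrap_ok_ends c mid d e s f :
  pairwise (fun x y : int => y < x) (c :: rcons mid d) -> c - d < n%:Z ->
  pairwise wrap_ok ((c, e) :: rcons (zip mid s) (d, f)) = wrap_ok (c, e) (d, f).
Proof.
rewrite !pairwise_cons pairwise_rcons !all_rcons.
case/andP=> /andP[dc /allP c_mid] /andP[/allP mid_d _] cd.
have -> : all (wrap_ok (c, e)) (zip mid s).
  have : all (fun y => y != c + 1 - n%:Z) mid.
    by apply/allP => y y_mid; have := mid_d y y_mid; lia.
  by move/(all_zip_fst s); apply: sub_all => y; rewrite /wrap_ok negb_and => ->.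
rewrite andbT pairwise_rcons.
have -> : all (wrap_ok^~ (d, f)) (zip mid s).
  have : all (fun y => d != y + 1 - n%:Z) mid.
    by apply/allP => y y_mid; have := c_mid y y_mid; lia.
  by move/(all_zip_fst s); apply: sub_all => y; rewrite /wrap_ok negb_and => ->.
suff -> : pairwise wrap_ok (zip mid s) by rewrite !andbT.
have {mid_d c_mid} : {in mid, forall x, d < x < c}.
  by move=> x x_mid; rewrite mid_d ?c_mid.
elim: mid s => [|x mid ih] [|b s] //= h; apply/andP; split; last first.
  by apply: ih => y y_mid; apply: h; rewrite inE y_mid orbT.
have : all (fun y => y != x + 1 - n%:Z) mid.
  apply/allP => y y_mid; have := h x (mem_head _ _).
  by have := h y; rewrite inE y_mid orbT => /(_ isT); lia.
by move/(all_zip_fst s); apply: sub_all => y; rewrite /wrap_ok negb_and => ->.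
Qed.

Lemma wrap_descent_sum c mid d :
  pairwise (fun x y : int => y < x) (c :: rcons mid d) -> c - d < n%:Z ->
  \sum_(s <- bitseqs (size (c :: rcons mid d)) |
     pairwise row_ok (zip (c :: rcons mid d) s) &&
     ~~ pairwise wrap_ok (zip (c :: rcons mid d) s))
     chain_word (zip (c :: rcons mid d) s) =
  if d == c + 1 - n%:Z then Y c false * chain_sum row_ok mid * Y d true else 0.
Proof.
move=> dec cd; rewrite big_mkcond [size (c :: _)]/= size_rcons [LHS]big_cat !big_map !bitseqs_rcons.
have zipE e f s : s \in bitseqs (size mid) ->
    zip (c :: rcons mid d) (e :: rcons s f) = (c, e) :: rcons (zip mid s) (d, f).
  by rewrite mem_bitseqs => /eqP sz; rewrite /= zip_rcons.
rewrite -[RHS]addr0; congr (_ + _); last first.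
  rewrite big_seq_cond big1 // => s; rewrite andbT => s_in; rewrite !zipE //.
  by rewrite !wrap_ok_ends // /wrap_ok /= !andbF /= addr0.
rewrite big_seq_cond.
rewrite (eq_bigr (fun s => if d == c + 1 - n%:Z then
    if pairwise row_ok (zip mid s) then Y c false * chain_word (zip mid s) * Y d true else 0
    else 0)); last first.
  move=> s; rewrite andbT => s_in; rewrite !zipE //.
  rewrite !wrap_ok_ends // /wrap_ok /= andbF /= andbF add0r andbT negbK.
  rewrite all_rcons pairwise_rcons.
  have -> : all (row_ok (c, false)) (zip mid s).
    by apply/allP => y _; rewrite /row_ok /= andbF.
  have -> : all (row_ok^~ (d, true)) (zip mid s).
    by apply/allP => y _; rewrite /row_ok /= !andbF.
  rewrite /row_ok /= andbF /= [_ && (d == _)]andbC; case: eqP => //= _.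
  by rewrite /chain_word big_cons big_rcons /= mulrA.
rewrite -big_seq_cond; case: ifP => _; last by rewrite big1.
by rewrite -big_mkcond /chain_sum mulr_sumr mulr_suml.
Qed.

(** Wrapping around the cylinder removes the words with a descent from the last
    content to the first.  These have the letters of a domino at their two ends,
    and the last one moves across to form it. *)
Lemma chain_sum_fixed cs :
  pairwise (fun x y : int => y < x) cs -> {in cs &, forall x y, x - y < n%:Z} ->
  R (chain_sum chain_ok cs) = chain_sum chain_ok cs.
Proof.
move=> dec bnd.
have small : (size cs < 2)%N ->
    R (chain_sum chain_ok cs) = chain_sum chain_ok cs.
  move=> sz; rewrite (_ : chain_sum chain_ok cs = chain_sum row_ok cs).
    exact: row_sum_fixed.
  apply: eq_bigl => s; case: cs sz {dec bnd} => [|c [|]] //; case: s => //.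
  by move=> b [].
case: cs dec bnd small => [|c cs] dec bnd; first by apply.
case/lastP: cs dec bnd => [|mid d] dec bnd; first by apply.
move=> _; have cd : c - d < n%:Z.
  by apply: bnd; rewrite inE ?eqxx // mem_rcons mem_head orbT.
have -> : chain_sum chain_ok (c :: rcons mid d) =
    chain_sum row_ok (c :: rcons mid d) -
    (if d == c + 1 - n%:Z then Y c false * chain_sum row_ok mid * Y d true else 0).
  rewrite -wrap_descent_sum //; apply/esym/eqP; rewrite subr_eq; apply/eqP.
  rewrite [LHS](bigID (fun s => pairwise wrap_ok (zip (c :: rcons mid d) s))).
  by congr (_ + _); apply: eq_bigl => s; rewrite -pairwise_relI.
rewrite rmorphB row_sum_fixed //; congr (_ - _).
case: eqP => [dE|_]; last by rewrite rmorph0.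
have cE : c = d + n%:Z - 1 by lia.
move: dec; rewrite pairwise_cons pairwise_rcons all_rcons.
case/andP=> /andP[dc /allP c_mid] /andP[/allP mid_d mid_dec].
have e : skew_comm eps (\sum_(x <- mid) comm d x) (Y d true) (chain_sum row_ok mid).
  apply: skew_comm_sum => // s; rewrite mem_bitseqs => /eqP sz _.
  rewrite (_ : \sum_(x <- mid) _ = \sum_(a <- zip mid s) comm d a.1).
    apply: skew_comm_prod => // -[x b] /(map_f fst).
    rewrite [map _ _]unzip1_zip ?sz //= => x_mid; apply: wrap_comm.
    by have := mid_d x x_mid; have := c_mid x x_mid; lia.
  by rewrite -(big_map fst xpredT (comm d)) [map _ _]unzip1_zip ?sz.
have {}e := skew_comm_sym eps_unit e.
rewrite -mulrA e [_ * (eps ^ _ * _)]mulrA -exp_central // -mulrA mulrA cE.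
rewrite -mulrA (mulrA (Y _ false)) rmorphM R_exp rmorphM R_wrap.
by rewrite row_sum_fixed.
Qed.
End Chains.

(** * Geometry of the cylinder *)

Section Cylinder.
Variables n s : nat.

Local Notation box := (box n s).
Let width : int := n%:Z - s%:Z.

Lemma periodE t : cyl_period n s *~ t = (width * t, s%:Z * t).
Proof.
rewrite [LHS]surjective_pairing.
by rewrite (raddfMz fst) (raddfMz snd) /= !mulrzz.
Qed.

Lemma boxP x y x' y' :
  box x y = box x' y' <-> exists t, x' = x + width * t /\ y' = y + s%:Z * t.
Proof.
split=> [/eqmodP/asboolP[t e]|[t [-> ->]]].
  exists t; move: e; rewrite periodE => -[ex ey].
  by split; [rewrite -ex|rewrite -ey]; rewrite addrC subrK.
apply/eqmodP/asboolP; exists t; rewrite periodE.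
by congr (_, _); rewrite /= addrAC subrr add0r.
Qed.

Lemma box_repr (b : cyl n s) : box (repr b).1 (repr b).2 = b.
Proof. by rewrite /Defs.box -surjective_pairing reprK. Qed.

Lemma right_of_box x y b : right_of (box x y) b <-> b = box (x + 1) y.
Proof.
split=> [[x' [y' [/boxP[t [-> ->]] ->]]]|->]; last by exists x, y.
by apply/boxP; exists (- t); split; ring.
Qed.

Lemma below_box x y b : below (box x y) b <-> b = box x (y - 1).
Proof.
split=> [[x' [y' [/boxP[t [-> ->]] ->]]]|->]; last by exists x, y.
by apply/boxP; exists (- t); split; ring.
Qed.

Lemma above_box x y b : below b (box x y) <-> b = box x (y + 1).
Proof.
split=> [[x' [y' [-> /boxP[t [xE yE]]]]]|->].
  by apply/boxP; exists (- t); rewrite xE; split; [ring|lia].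
by exists x, (y + 1); split; rewrite // addrK.
Qed.

Lemma below_inj (b c c' : cyl n s) : below b c -> below b c' -> c = c'.
Proof. by rewrite -(box_repr b) => /below_box -> /below_box ->. Qed.

Lemma above_inj (b b' c : cyl n s) : below b c -> below b' c -> b = b'.
Proof. by rewrite -(box_repr c) => /above_box -> /above_box ->. Qed.

Lemma cyl_lt_box x y (dx dy : nat) : (0 < dx + dy)%N ->
  cyl_lt (box x y) (box (x + dx%:Z) (y - dy%:Z)).
Proof.
elim: dx x => [|dx ih] x; last first.
  have st : cyl_lt (box x y) (box (x + 1) y).
    by constructor; left; apply/right_of_box.
  move=> _; have [/eqP|dpos] := posnP (dx + dy)%N.
    by rewrite addn_eq0 => /andP[/eqP-> /eqP->]; rewrite subr0.
  apply: t_trans st _; rewrite (_ : x + dx.+1%:Z = x + 1 + dx%:Z); [exact: ih|lia].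
rewrite add0n addr0; elim: dy y => // dy ih y _.
have st : cyl_lt (box x y) (box x (y - 1)).
  by constructor; right; apply/below_box.
have [->//|dpos] := posnP dy.
by apply: t_trans st _; rewrite (_ : y - dy.+1%:Z = y - 1 - dy%:Z); [exact: ih|lia].
Qed.

Lemma convex_box (D : {fset cyl n s}) (x y x' y' x'' y'' : int) :
  cylindric_skew_shape D -> box x y \in D -> box x' y' \in D ->
  x <= x'' -> x'' <= x' -> y' <= y'' -> y'' <= y -> box x'' y'' \in D.
Proof.
move=> cD bD b'D h1 h2 h3 h4.
have [/andP[/eqP <- /eqP <-]//|ne] := boolP ((x == x'') && (y == y'')).
have [/andP[/eqP -> /eqP ->]//|ne'] := boolP ((x'' == x') && (y'' == y')).
apply: (cD _ _ _ bD b'D).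
  have -> : x'' = x + (`|x'' - x|%N)%:Z by lia.
  have -> : y'' = y - (`|y - y''|%N)%:Z by lia.
  by apply: cyl_lt_box; lia.
have -> : x' = x'' + (`|x' - x''|%N)%:Z by lia.
have -> : y' = y'' - (`|y'' - y'|%N)%:Z by lia.
by apply: cyl_lt_box; lia.
Qed.

Variable x0 : int.
Let rep := @rep_in n s x0.

Lemma box_rep b : box (rep b).1 (rep b).2 = b.
Proof.
rewrite -{3}(box_repr b); apply/boxP.
exists (((repr b).1 - x0) %/ width)%Z.
by rewrite /rep /rep_in periodE /= !subrK.
Qed.

Hypothesis hs : (1 <= s <= n.-1)%N.

Lemma width_gt0 : 0 < width.
Proof. rewrite /width; lia. Qed.

Lemma rep_bounds b : x0 <= (rep b).1 < x0 + width.
Proof.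
have w0 := width_gt0; rewrite /rep /rep_in periodE /=.
set a := (repr b).1; have := divz_eq (a - x0) width.
have := ltz_pmod (a - x0) w0; have := modz_ge0 (a - x0) (lt0r_neq0 w0).
move: ((a - x0) %/ width)%Z ((a - x0) %% width)%Z => k l l0 lw e.
rewrite mulrC; lia.
Qed.

Lemma rep_box x y : x0 <= x < x0 + width -> rep (box x y) = (x, y).
Proof.
move=> xw; have /boxP[t [xE yE]] := box_rep (box x y).
have bb := rep_bounds (box x y).
have t0 : t = 0.
  have : -1 < t < 1 by apply/andP; split; nia.
  lia.
rewrite t0 !mulr0 !addr0 in xE yE.
by rewrite [LHS]surjective_pairing -xE -yE.
Qed.

Lemma rep_inj : injective rep.
Proof. by move=> b b' e; rewrite -(box_rep b) -(box_rep b') -/rep e. Qed.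

Lemma right_of_lifted b b' : (rep b).1 < (rep b').1 ->
  right_of b b' -> rep b' = ((rep b).1 + 1, (rep b).2).
Proof.
rewrite -{2}(box_rep b) => lt /right_of_box; rewrite -{1}(box_rep b').
case/boxP=> t [xE yE]; have := rep_bounds b; have := rep_bounds b'.
move=> bb bb'; have w0 := width_gt0.
have t0 : t = 0.
  have : -1 < t < 1 by apply/andP; split; nia.
  lia.
by rewrite [LHS]surjective_pairing xE yE t0 !mulr0 !addr0.
Qed.

Lemma right_of_lifted_wrap b b' : (rep b').1 < (rep b).1 -> right_of b b' ->
  (rep b').1 = (rep b).1 + 1 - width /\ (rep b').2 = (rep b).2 - s%:Z.
Proof.
rewrite -{2}(box_rep b) => lt /right_of_box; rewrite -{1}(box_rep b').
case/boxP=> t [xE yE]; have := rep_bounds b; have := rep_bounds b'.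
move=> bb bb'; have w0 := width_gt0.
have t0 : t = 1.
  have : 0 < t < 2 by apply/andP; split; nia.
  lia.
by move: xE yE; rewrite t0 !mulr1 => -> ->; rewrite !addrK.
Qed.
Definition lifted_content b : int := - (rep b).1 - (rep b).2.

Hypothesis hn : (2 < n)%N.

Lemma content_box x y : content (box x y) = (- x - y)%:~R :> 'Z_n.
Proof.
rewrite /content; have /boxP[t [-> ->]] := esym (box_repr (box x y)).
have -> : - (x + width * t) - (y + s%:Z * t) = - x - y - n%:Z * t.
  by rewrite /width; ring.
by rewrite [LHS]rmorphB /= intrM -pmulrn Zn_natr0 // mul0r subr0.
Qed.

Lemma content_lifted b : content b = (lifted_content b)%:~R :> 'Z_n.
Proof. by rewrite -{1}(box_rep b) content_box. Qed.

End Cylinder.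

(** * Free boxes of a tableau *)

Section TwoRowMoves.
Variables n m s : nat.
Variable D : {fset cyl n s}.
Hypothesis cD : cylindric_skew_shape D.
Variables (j j' : 'I_m).
Hypothesis jj' : j' = j.+1 :> nat.

Local Notation box := (box n s).
Local Notation tableau := {ffun D -> 'I_m}.
Implicit Types (T : tableau) (b : D).

Definition movable (l : 'I_m) := (l == j) || (l == j').

Definition domino_top T b :=
  (T b == j) && [exists b', `[< below (val b) (val b') >] && (T b' == j')].

Definition domino_bottom T b :=
  (T b == j') && [exists b', `[< below (val b') (val b) >] && (T b' == j)].

Definition free_box T b :=
  [&& movable (T b), ~~ domino_top T b & ~~ domino_bottom T b].

Lemma movableE l : movable l = (j <= l <= j')%N.
Proof. by rewrite /movable -!val_eqE /= jj'; lia. Qed.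

Lemma squeezed_left (l l' l'' : 'I_m) : movable l -> (l < l')%N -> (l' <= l'')%N ->
  movable l'' -> l = j /\ l' = j'.
Proof. by rewrite !movableE => *; split; apply: val_inj => /=; lia. Qed.

Lemma squeezed_right (l l' l'' : 'I_m) : movable l -> (l <= l')%N -> (l' < l'')%N ->
  movable l'' -> l' = j /\ l'' = j'.
Proof. by rewrite !movableE => *; split; apply: val_inj => /=; lia. Qed.

Local Notation upd e := (if e then j' else j).

Lemma upd_mono (e e' : bool) : (e -> e') -> (upd e <= upd e')%N.
Proof. by case: e; case: e' => // h; [have := h isT|lia]. Qed.

Lemma upd_le (l l' : 'I_m) e : movable l -> (l <= l')%N ->
  (upd e <= l')%N \/ l' = j.
Proof.
rewrite movableE => ml ll'; have [->|ne] := eqVneq l' j; [by right|left].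
by move: ne; rewrite -val_eqE /=; case: e; lia.
Qed.

Lemma le_upd (l l' : 'I_m) e : movable l' -> (l <= l')%N ->
  (l <= upd e)%N \/ l = j'.
Proof.
rewrite movableE => ml ll'; have [->|ne] := eqVneq l j'; [by right|left].
by move: ne; rewrite -val_eqE /=; case: e; lia.
Qed.

Lemma upd_lt (l l' : 'I_m) e : movable l -> ~~ movable l' -> (l < l')%N ->
  (upd e < l')%N.
Proof. by rewrite !movableE; case: e; lia. Qed.

Lemma lt_upd (l l' : 'I_m) e : ~~ movable l -> movable l' -> (l < l')%N ->
  (l < upd e)%N.
Proof. by rewrite !movableE; case: e; lia. Qed.

Lemma free_movable T b : free_box T b -> movable (T b).
Proof. by case/and3P. Qed.

Lemma free_below T b b' : below (val b) (val b') ->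
  T b = j -> T b' = j' -> ~~ free_box T b /\ ~~ free_box T b'.
Proof.
move=> bb' Tb Tb'.
have t : domino_top T b.
  by rewrite /domino_top Tb eqxx; apply/existsP; exists b'; rewrite Tb' eqxx asboolT.
have l : domino_bottom T b'.
  by rewrite /domino_bottom Tb' eqxx; apply/existsP; exists b; rewrite Tb eqxx asboolT.
by rewrite /free_box t l !andbF.
Qed.

Lemma convex_in b b' x y x' y' x'' y'' :
  val b = box x y -> val b' = box x' y' ->
  x <= x'' -> x'' <= x' -> y' <= y'' -> y'' <= y -> box x'' y'' \in D.
Proof.
move=> bE b'E; have bD := fsvalP b; have b'D := fsvalP b'.
rewrite bE in bD; rewrite b'E in b'D.
move: cD bD b'D.
exact: convex_box.
Qed.

(** Convexity provides the boxes of a path from [b] to [b'], along which the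
    entries grow. *)
Lemma semistandard_le T b b' x y (dx dy : nat) : semistandard T ->
  val b = box x y -> val b' = box (x + dx%:Z) (y - dy%:Z) ->
  (T b + dy <= T b')%N.
Proof.
move=> sT; elim: dx x y dy b => [|dx ih] x y dy b; last first.
  move=> bE b'E; have bD : box (x + 1) y \in D by apply: (convex_in bE b'E); lia.
  have := ih (x + 1) y dy [` bD]%fset erefl.
  rewrite b'E (_ : x + 1 + dx%:Z = x + dx.+1%:Z); last by lia.
  move/(_ erefl); apply: leq_trans; rewrite leq_add2r.
  by apply: (sT b _).1; rewrite bE; apply/right_of_box.
rewrite addr0; elim: dy y b => [|dy ih] y b bE b'E.
  by rewrite addn0 (_ : b' = b) //; apply: val_inj; rewrite bE b'E subr0.
have bD : box x (y - 1) \in D by apply: (convex_in bE b'E); lia.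
have := ih (y - 1) [` bD]%fset erefl.
rewrite b'E (_ : y - 1 - dy%:Z = y - dy.+1%:Z); last by lia.
move/(_ erefl); apply: leq_trans; rewrite addnS -addSn leq_add2r.
by apply: (sT b _).2; rewrite bE; apply/below_box.
Qed.

Lemma semistandard_leP T b b' x y x' y' : semistandard T ->
  val b = box x y -> val b' = box x' y' -> x <= x' -> y' <= y ->
  (T b)%:Z + (y - y') <= (T b')%:Z.
Proof.
move=> sT bE b'E xx yy.
have xE : x' = x + (`|x' - x|%N)%:Z by lia.
have yE : y' = y - (`|y - y'|%N)%:Z by lia.
rewrite xE yE in b'E.
by have := semistandard_le sT bE b'E; lia.
Qed.

(** Between two movable entries, one strictly lower than the other and not to its
    left, entries can increase only once.  By convexity the first one then has
    [j'] just below it, and the second one has [j] just above it, so that none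
    of the two is free. *)
Lemma free_above T b b' x y x' y' : semistandard T ->
  free_box T b -> movable (T b') -> val b = box x y -> val b' = box x' y' ->
  x <= x' -> y <= y'.
Proof.
move=> sT fb mb' bE b'E xx; case: (lerP y y') => // yy.
have mb := free_movable fb.
have bD : box x (y - 1) \in D by apply: (convex_in bE b'E); lia.
have le1 := semistandard_leP sT bE b'E xx (ltW yy).
have [c cE] : exists c : D, val c = box x (y - 1) by exists [` bD]%fset.
have bc : below (val b) (val c) by rewrite bE; apply/below_box.
have le2 := (sT b c).2 bc.
have le3 : (T c <= T b')%N.
  by have := semistandard_leP sT cE b'E xx; lia.
have [Tb Tc] := squeezed_left mb le2 le3 mb'.
by have [] := free_below bc Tb Tc; rewrite fb.
Qed.

Lemma free_below_right T b b' x y x' y' : semistandard T ->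
  movable (T b) -> free_box T b' -> val b = box x y -> val b' = box x' y' ->
  x <= x' -> y <= y'.
Proof.
move=> sT mb fb' bE b'E xx; case: (lerP y y') => // yy.
have mb' := free_movable fb'.
have bD : box x' (y' + 1) \in D by apply: (convex_in bE b'E); lia.
have le1 := semistandard_leP sT bE b'E xx (ltW yy).
have [c cE] : exists c : D, val c = box x' (y' + 1) by exists [` bD]%fset.
have bc : below (val c) (val b') by rewrite b'E; apply/above_box.
have le2 := (sT c b').2 bc.
have le3 : (T b <= T c)%N.
  by have := semistandard_leP sT bE cE xx; lia.
have [Tc Tb'] := squeezed_right mb le3 le2 mb'.
by have [_] := free_below bc Tc Tb'; rewrite fb'.
Qed.

Definition assign T (sg : pred D) : tableau :=
  [ffun b => if free_box T b then (if sg b then j' else j) else T b].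

Lemma assign_movable T sg b : movable (assign T sg b) = movable (T b).
Proof.
rewrite ffunE; case: (boolP (free_box T b)) => // /free_movable ->.
by rewrite /movable; case: ifP; rewrite eqxx ?orbT.
Qed.

Lemma domino_topP T b :
  reflect (T b = j /\ exists2 b', below (val b) (val b') & T b' = j') (domino_top T b).
Proof.
apply: (iffP andP) => [[/eqP-> /existsP[b' /andP[/asboolP bb' /eqP Tb']]]|].
  by split=> //; exists b'.
move=> [-> [b' bb' Tb']]; split=> //; apply/existsP; exists b'.
by rewrite Tb' eqxx asboolT.
Qed.

Lemma domino_bottomP T b :
  reflect (T b = j' /\ exists2 b', below (val b') (val b) & T b' = j) (domino_bottom T b).
Proof.
apply: (iffP andP) => [[/eqP-> /existsP[b' /andP[/asboolP bb' /eqP Tb']]]|].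
  by split=> //; exists b'.
move=> [-> [b' bb' Tb']]; split=> //; apply/existsP; exists b'.
by rewrite Tb' eqxx asboolT.
Qed.

Lemma not_free_upper T b : T b = j -> ~~ free_box T b -> domino_top T b.
Proof.
move=> Tb; rewrite /free_box /movable Tb eqxx /=; case: domino_top => //=.
by rewrite negbK => /domino_bottomP[]; rewrite Tb => /(congr1 val) /=; lia.
Qed.

Lemma not_free_lower T b : T b = j' -> ~~ free_box T b -> domino_bottom T b.
Proof.
move=> Tb; rewrite /free_box /movable Tb eqxx orbT /=; case: domino_bottom => //=.
by rewrite andbT negbK => /domino_topP[]; rewrite Tb => /(congr1 val) /=; lia.
Qed.

Lemma free_not_below T b b' : semistandard T -> below (val b) (val b') ->
  movable (T b) -> movable (T b') -> free_box T b || free_box T b' -> False.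
Proof.
move=> sT; rewrite -(box_repr (val b)) => /below_box b'E mb mb' /orP[] f.
  by have := free_above sT f mb' (esym (box_repr _)) b'E (lexx _); lia.
by have := free_below_right sT mb f (esym (box_repr _)) b'E (lexx _); lia.
Qed.

(** A neighbor that is not free but in the way would belong to a domino, whose
    other box makes, by convexity, a domino of the free box as well. *)
Lemma assign_semistandard T (sg : pred D) : semistandard T ->
  (forall b b', free_box T b -> free_box T b' -> right_of (val b) (val b') ->
     sg b -> sg b') ->
  semistandard (assign T sg).
Proof.
move=> sT hsg b b'; have [le_r lt_b] := sT b b'; split=> bb'; rewrite !ffunE.
  have le := le_r bb'.
  case: (boolP (free_box T b)) => fb; case: (boolP (free_box T b')) => fb'.
  - by apply: upd_mono; apply: hsg.
  - case: (upd_le (sg b) (free_movable fb) le) => // Tb'.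
    case: (domino_topP _ _ (not_free_upper Tb' fb')) => _ [c b'c Tc].
    move: bb'; rewrite -(box_repr (val b)) => /right_of_box b'E.
    move: b'c; rewrite b'E => /below_box cE.
    have mc : movable (T c) by rewrite /movable Tc eqxx orbT.
    have := free_above sT fb mc (esym (box_repr _)) cE.
    by rewrite lerDl => /(_ isT); lia.
  - case: (le_upd (sg b') (free_movable fb') le) => // Tb.
    case: (domino_bottomP _ _ (not_free_lower Tb fb)) => _ [c cb Tc].
    move: bb' cb; rewrite -(box_repr (val b)) => /right_of_box b'E /above_box cE.
    have mc : movable (T c) by rewrite /movable Tc eqxx.
    have := free_below_right sT mc fb' cE b'E.
    by rewrite lerDl => /(_ isT); lia.
  - by [].
have lt := lt_b bb'.
case: (boolP (free_box T b)) => fb; case: (boolP (free_box T b')) => fb' //.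
- by case: (free_not_below sT bb' (free_movable fb) (free_movable fb')); rewrite fb.
- have [mb'|nmb'] := boolP (movable (T b')).
    by case: (free_not_below sT bb' (free_movable fb) mb'); rewrite fb.
  exact: upd_lt (free_movable fb) nmb' lt.
- have [mb|nmb] := boolP (movable (T b)).
    by case: (free_not_below sT bb' mb (free_movable fb')); rewrite fb' orbT.
  exact: lt_upd nmb (free_movable fb') lt.
Qed.

Lemma assign_domino T sg b b' : semistandard T -> below (val b) (val b') ->
  (assign T sg b == j) && (assign T sg b' == j') = (T b == j) && (T b' == j').
Proof.
move=> sT bb'.
have out (U : tableau) : (movable (U b) = movable (T b)) -> movable (U b') = movable (T b') ->
   free_box T b || free_box T b' -> (U b == j) && (U b' == j') = false.
  move=> mb mb' f; apply/negP => /andP[Ub Ub'].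
  apply: (free_not_below sT bb' _ _ f); rewrite -?mb -?mb' /movable ?Ub //.
  by rewrite Ub' orbT.
have [f|] := boolP (free_box T b || free_box T b').
  by rewrite !out // assign_movable.
by rewrite negb_or !ffunE => /andP[/negPf-> /negPf->].
Qed.

Lemma assign_free T sg b : semistandard T -> free_box (assign T sg) b = free_box T b.
Proof.
move=> sT; rewrite /free_box assign_movable; congr [&& _, ~~ _ & ~~ _].
  apply/domino_topP/domino_topP => -[/eqP eb [c bc /eqP ec]];
  have := assign_domino sg sT bc; rewrite eb ec.
    by case/esym/andP => /eqP -> /eqP; split; last exists c.
  by case/andP => /eqP -> /eqP; split; last exists c.
apply/domino_bottomP/domino_bottomP => -[/eqP eb [c bc /eqP ec]];
have := assign_domino sg sT bc; rewrite eb ec.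
  by case/esym/andP => /eqP h /eqP ->; split; last exists c.
by case/andP => /eqP h /eqP ->; split; last exists c.
Qed.
End TwoRowMoves.

(** * Reading order and contents of the free boxes *)

Section ReadingOrder.
Variables n s : nat.
Variable D : {fset cyl n s}.
Variable x0 : int.

Let rep (b : D) := rep_in x0 (val b).
Let before (a b : D) := reads_before x0 (val a) (val b).

Lemma before_trans : transitive before.
Proof. by move=> b a c; rewrite /before /reads_before; lia. Qed.

Lemma before_total : total before.
Proof. by move=> a b; rewrite /before /reads_before; lia. Qed.

Lemma before_anti : antisymmetric before.
Proof.
move=> a b; rewrite /before /reads_before => ab.
apply/val_inj/(@rep_inj _ _ x0).
by rewrite [LHS]surjective_pairing [RHS]surjective_pairing; congr (_, _); lia.
Qed.

Let L := reading_order D x0.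

Lemma reading_order_perm : perm_eq L (enum {: D}).
Proof. by rewrite perm_sort. Qed.

Lemma reading_order_uniq : uniq L.
Proof. by rewrite (perm_uniq reading_order_perm) enum_uniq. Qed.

Lemma mem_reading_order b : b \in L.
Proof. by rewrite (perm_mem reading_order_perm) mem_enum. Qed.

Lemma reading_order_pairwise :
  pairwise (fun a b => before a b && ~~ before b a) L.
Proof.
have: pairwise before L && pairwise (fun a b => a != b) L.
  by rewrite -uniq_pairwise reading_order_uniq -(sorted_pairwise before_trans)
             (sort_sorted before_total).
rewrite -pairwise_relI; apply: sub_pairwise => a b /= /andP[ab ne].
by rewrite ab; apply: contra ne => ba; apply/eqP/before_anti; rewrite ab ba.
Qed.

End ReadingOrder.

Section FreeChain.
Variables n m s : nat.
Hypothesis hs : (1 <= s <= n.-1)%N.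
Variable D : {fset cyl n s}.
Hypothesis cD : cylindric_skew_shape D.
Variables (j j' : 'I_m).
Hypothesis jj' : j' = j.+1 :> nat.
Variable x0 : int.
Variable T : {ffun D -> 'I_m}.
Hypothesis sT : semistandard T.

Local Notation box := (box n s).
Local Notation free_box := (free_box j j').
Local Notation movable := (movable j j').
Let width : int := n%:Z - s%:Z.
Let rep (b : D) := rep_in x0 (val b).
Let before (a b : D) := reads_before x0 (val a) (val b).
Let height (b : D) := lifted_content x0 (val b).

Lemma valE b : val b = box (rep b).1 (rep b).2.
Proof. by rewrite box_rep. Qed.

Lemma valE_next b : val b = box ((rep b).1 + width) ((rep b).2 + s%:Z).
Proof. by rewrite {1}valE; apply/boxP; exists 1; rewrite !mulr1. Qed.

Lemma free_column a b : free_box T a -> movable (T b) -> a != b ->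
  (rep a).1 != (rep b).1.
Proof.
move=> fa mb; apply: contra => /eqP e; apply/eqP/val_inj/(@rep_inj _ _ x0).
have := free_above cD jj' sT fa mb (valE a) (valE b).
have := free_below_right cD jj' sT mb fa (valE b) (valE a).
rewrite e lexx => /(_ isT) h1 /(_ isT) h2.
rewrite [LHS]surjective_pairing [RHS]surjective_pairing -!/(rep _).
by rewrite e; congr (_, _); lia.
Qed.

Lemma free_order a b : free_box T a -> free_box T b -> before a b && ~~ before b a ->
  [/\ (rep a).1 < (rep b).1, (rep a).2 <= (rep b).2 &
      (rep b).2 <= (rep a).2 + s%:Z].
Proof.
move=> fa fb ab; have ab_ne : a != b by apply/eqP => e; move: ab; rewrite e andbN.
have ne := free_column fa (free_movable fb) ab_ne.
have lt : (rep a).1 < (rep b).1.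
  by move: ab ne; rewrite /before /reads_before -!/(rep _); lia.
split=> //.
  exact: (free_above cD jj' sT fa (free_movable fb) (valE a) (valE b) (ltW lt)).
apply: (free_above cD jj' sT fb (free_movable fa) (valE b) (valE_next a)).
have := rep_bounds x0 hs (val a); have := rep_bounds x0 hs (val b).
by rewrite -!/(rep _) /width; lia.
Qed.

(** Going once around the cylinder the content drops by [n], hence the contents
    of the free boxes in a fundamental domain fill less than one turn. *)
Lemma free_contents a b : free_box T a -> free_box T b -> before a b && ~~ before b a ->
  height b < height a < height b + n%:Z.
Proof.
move=> fa fb ab; have [] := free_order fa fb ab.
have := rep_bounds x0 hs (val a); have := rep_bounds x0 hs (val b).
by rewrite /height /lifted_content -!/(rep _); lia.
Qed.

(** Since contents of free boxes spread over less than one turn, contents that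
    differ by [1], possibly around the cylinder, occur only for neighbors in a
    row. *)
Lemma free_chain_ok a b e f : free_box T a -> free_box T b -> before a b && ~~ before b a ->
  chain_ok n (height a, e) (height b, f) <->
  (right_of (val a) (val b) -> e -> f) /\ (right_of (val b) (val a) -> f -> e).
Proof.
move=> fa fb ab; have [lt le1 le2] := free_order fa fb ab.
have ba := rep_bounds x0 hs (val a); have bb := rep_bounds x0 hs (val b).
rewrite -!/(rep _) in ba bb.
have row : height a = height b + 1 <-> right_of (val a) (val b).
  split=> [|r].
    rewrite /height /lifted_content -!/(rep _) => h.
    rewrite (valE a) (valE b); apply/right_of_box.
    by congr (Defs.box _ _ _ _); lia.
  have := right_of_lifted hs lt r.
  by rewrite -/(rep _) /height /lifted_content -!/(rep _) => -> /=; lia.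
have wrap : height b = height a + 1 - n%:Z <-> right_of (val b) (val a).
  split=> [|r].
    rewrite /height /lifted_content -!/(rep _) => h.
    rewrite (valE b) (valE_next a); apply/right_of_box.
    by congr (Defs.box _ _ _ _); rewrite /width; lia.
  have := right_of_lifted_wrap hs lt r; rewrite -!/(rep _) /height /lifted_content -!/(rep _).
  by move=> [-> ->]; lia.
rewrite /chain_ok /row_ok /wrap_ok /=; split.
  case/andP=> h1 h2; split=> [/row h|/wrap h].
    by move: h1; rewrite h eqxx /=; case: (e); case: (f).
  by move: h2; rewrite h eqxx /=; case: (e); case: (f).
move=> [h1 h2]; apply/andP; split; apply/negP => /and3P[/eqP].
  by move=> /row /h1 h /h ->.
by move=> /wrap /h2 h /h ->.
Qed.
End FreeChain.

(** * Dominoes *)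

Lemma pairwise_ordered (I : eqType) (lt rl : rel I) (l : seq I) :
  (forall a b, lt a b -> ~~ lt b a) -> pairwise lt l -> pairwise rl l ->
  {in l &, forall a b, lt a b -> rl a b}.
Proof.
move=> asym; elim: l => // x l ih; rewrite !pairwise_cons.
case/andP=> /allP lt_x lt_l /andP[/allP rl_x rl_l] a b.
rewrite !inE => /predU1P[->|a_l] /predU1P[->|b_l].
- by move=> h; have := asym _ _ h; rewrite h.
- by move=> _; apply: rl_x.
- by move=> h; have := asym _ _ h; rewrite lt_x.
- exact: (ih lt_l rl_l).
Qed.

Lemma content_below n s (b c : cyl n s) : (2 < n)%N ->
  below b c -> content c = content b + 1 :> 'Z_n.
Proof.
move=> hn; rewrite -(box_repr b) => /below_box ->; rewrite !content_box //.
by rewrite -[RHS](intrD _ _ 1); congr (_%:~R); ring.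
Qed.

Section DominoPartner.
Variables n m s : nat.
Variable D : {fset cyl n s}.
Variables (j j' : 'I_m).
Hypothesis jj' : j' = j.+1 :> nat.
Variable T : {ffun D -> 'I_m}.

Local Notation free_box := (free_box j j').
Local Notation movable := (movable j j').
Local Notation top := (domino_top j j' T).
Local Notation bottom := (domino_bottom j j' T).

(** Exchanges the two boxes of a domino and fixes the other boxes, to serve as a
    reindexing of sums over all boxes. *)
Definition partner (b : D) : D :=
  if top b then odflt b [pick c | `[< below (val b) (val c) >] && (T c == j')]
  else if bottom b then
    odflt b [pick c | `[< below (val c) (val b) >] && (T c == j)]
  else b.

Lemma top_partner b : top b ->
  below (val b) (val (partner b)) /\ T (partner b) = j'.
Proof.
move=> tb; rewrite /partner tb; case: pickP => [c /andP[/asboolP bc /eqP Tc]|h] //=.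
case/domino_topP: tb => _ [c bc Tc].
by have := h c; rewrite asboolT // Tc eqxx.
Qed.

Lemma bottom_top b : bottom b -> top b = false.
Proof.
case/domino_bottomP => Tb _; apply/negP => /domino_topP[].
by rewrite Tb => /(congr1 val) /=; lia.
Qed.

Lemma bottom_partner b : bottom b ->
  below (val (partner b)) (val b) /\ T (partner b) = j.
Proof.
move=> bb; rewrite /partner bottom_top // bb.
case: pickP => [c /andP[/asboolP bc /eqP Tc]|h] //=.
case/domino_bottomP: bb => _ [c bc Tc].
by have := h c; rewrite asboolT // Tc eqxx.
Qed.

Lemma partner_top b : top b -> bottom (partner b).
Proof.
move=> tb; have [bc Tc] := top_partner tb; apply/domino_bottomP; split=> //.
by exists b; rewrite // ; case/domino_topP: tb.
Qed.

Lemma partner_bottom b : bottom b -> top (partner b).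
Proof.
move=> bb; have [bc Tc] := bottom_partner bb; apply/domino_topP; split=> //.
by exists b; rewrite // ; case/domino_bottomP: bb.
Qed.

Lemma partner_single b : top b = false -> bottom b = false -> partner b = b.
Proof. by rewrite /partner => -> ->. Qed.

Lemma partnerK : involutive partner.
Proof.
move=> b; case tb: (top b).
  have [bc _] := top_partner tb; have [bc' _] := bottom_partner (partner_top tb).
  exact/val_inj/(above_inj bc' bc).
case bb: (bottom b); last by rewrite !partner_single.
have [bc _] := bottom_partner bb; have [bc' _] := top_partner (partner_bottom bb).
exact/val_inj/(below_inj bc' bc).
Qed.

Lemma not_free_partner b : free_box T (partner b) = free_box T b.
Proof.
case tb: (top b).
  by rewrite /free_box tb (partner_top tb) !andbF.
case bb: (bottom b); last by rewrite partner_single.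
by rewrite /free_box bb (partner_bottom bb) !andbF.
Qed.

Hypothesis hn : (2 < n)%N.
Variable r : 'Z_n.

Definition box_letter (U : {ffun D -> 'I_m}) (b : D) : letter m n :=
  (U b, content (val b) + r).

Lemma letter_top b : top b -> box_letter T b = (j, content (val b) + r).
Proof. by case/domino_topP => Tb _; rewrite /box_letter Tb. Qed.

Lemma letter_partner b : top b ->
  box_letter T (partner b) = (j', content (val b) + r + 1).
Proof.
move=> tb; have [bc Tc] := top_partner tb.
by rewrite /box_letter Tc (content_below hn bc) addrAC.
Qed.

Lemma comm_exp_unmovable l k (a : letter m n) : movable l -> ~~ movable a.1 ->
  comm_exp (l, k) a = comm_exp (j, k) a.
Proof.
rewrite !movableE // => ml ma; rewrite /comm_exp /=.
by congr (_ * comm_sign _ - _ * comm_sign _ + _ * (_ * (_%:Z - _%:Z))); lia.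
Qed.

(** The change of the exponent when the entry of a free box changes is opposite
    on the two boxes of a domino, and zero on boxes of other rows. *)
Lemma partner_comm_exp l k b : movable l -> ~~ free_box T b ->
  comm_exp (l, k) (box_letter T b) - comm_exp (j, k) (box_letter T b) =
  - (comm_exp (l, k) (box_letter T (partner b))
     - comm_exp (j, k) (box_letter T (partner b))).
Proof.
move=> ml nfb.
have dom c : top c ->
  comm_exp (l, k) (box_letter T c) - comm_exp (j, k) (box_letter T c) =
  - (comm_exp (l, k) (box_letter T (partner c))
     - comm_exp (j, k) (box_letter T (partner c))).
  move=> tc; rewrite letter_top // letter_partner //.
  have := comm_exp_domino jj' (content (val c) + r) (a := (l, k)) ml.
  have := comm_exp_domino jj' (content (val c) + r) (a := (j, k)).
  by rewrite /= eqxx => /(_ isT); lia.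
case tb: (top b); first exact: dom.
case bb: (bottom b).
  by have := dom _ (partner_bottom bb); rewrite partnerK => ->; rewrite opprK.
have nm : ~~ movable (T b) by move: nfb; rewrite /free_box tb bb !andbT.
by rewrite partner_single // comm_exp_unmovable // subrr oppr0.
Qed.

End DominoPartner.

(** * Invariance under one R-matrix *)

Section Invariance.
Variables n m s : nat.
Hypothesis hn : (2 < n)%N.
Hypothesis hs : (1 <= s <= n.-1)%N.
Variable D : {fset cyl n s}.
Hypothesis cD : cylindric_skew_shape D.
Variables (j j' : 'I_m).
Hypothesis jj' : j' = j.+1 :> nat.
Variables (x0 : int) (r : 'Z_n).

Variables (Q : unitRingType) (eps : Q) (q : 'I_m -> 'Z_n -> Q).
Hypothesis rel_q : torus_relations eps q.
Hypothesis division : forall x : Q, x != 0 -> x \is a GRing.unit.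
Variable R : {rmorphism Q -> Q}.
Hypothesis hR : is_R_matrix eps q j j' R.

Let eps_unit := tr_eps_unit rel_q.
Let eps_central := tr_eps_central rel_q.
Let L := reading_order D x0.
Let before (a b : D) := reads_before x0 (val a) (val b).
Let lt (a b : D) := before a b && ~~ before b a.
Let height (b : D) := lifted_content x0 (val b).

Local Notation tableau := {ffun D -> 'I_m}.
Local Notation free_box := (free_box j j').
Local Notation movable := (movable j j').
Local Notation box_letter := (box_letter r).

Lemma reading_wordE (U : tableau) :
  reading_word q x0 r U = \prod_(b <- L) gen q (box_letter U b).
Proof. by apply: eq_bigr => b _; rewrite /gen /=; congr (q _ _); ring. Qed.

Let Y (c : int) (e : bool) : Q := gen q (if e then j' else j, c%:~R + r).

Lemma chain_fixed (cs : seq int) :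
  pairwise (fun x y : int => y < x) cs -> {in cs &, forall x y, x - y < n%:Z} ->
  R (chain_sum Y (chain_ok n) cs) = chain_sum Y (chain_ok n) cs.
Proof.
have colorS c : (c + 1)%:~R + r = c%:~R + r + 1 :> 'Z_n by rewrite intrD addrAC.
pose e d x : int := - ((x%:~R + r : 'Z_n) == d%:~R + r + 1)%:Z.
apply: (chain_sum_fixed eps_unit eps_central hn _ _ _ (comm := e)).
- by move=> z; apply: (R_exp rel_q hR).
- by move=> c; apply: (R_sum hn rel_q jj' division hR).
- by move=> c; rewrite /Y colorS; apply: (R_domino_swap hn rel_q jj' division hR).
- move=> d x f dx; rewrite /Y /e.
  set a := (j', _); set b := (if f then _ else _, _).
  rewrite (_ : - _ = comm_exp a b); first exact: gen_comm.
  rewrite /comm_exp /a /b /=.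
  have ne z : 0 < z < n%:Z -> (z%:~R == 0 :> 'Z_n) = false.
    case: z => // z zn; rewrite -pmulrn Zn_natr_eq0 //; apply/negP => /dvdn_leq; lia.
  have -> : (d%:~R + r == x%:~R + r + 1 :> 'Z_n) = false.
    rewrite eq_sym -subr_eq0 (_ : _ - _ = (x + 1 - d)%:~R).
      by apply: ne; lia.
    by rewrite rmorphB rmorphD /=; ring.
  have -> : (d%:~R + r == x%:~R + r :> 'Z_n) = false.
    rewrite eq_sym -subr_eq0 (_ : _ - _ = (x - d)%:~R); first by apply: ne; lia.
    by rewrite rmorphB /=; ring.
  by case: f {b}; rewrite !mul0r addr0 sub0r jj' ?leqnn ?leqnSn mulr1.
- move=> d; rewrite /Y (_ : d%:~R + r = (d + n%:Z - 1)%:~R + r + 1).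
    exact: (R_domino hn rel_q jj' division hR).
  by rewrite rmorphB rmorphD /= -pmulrn Zn_natr0 //; ring.
Qed.

(** Tableaux with the same key differ only in the choice of [j] or [j'] in the
    free boxes. *)
Definition key (U : tableau) : {ffun D -> option 'I_m} :=
  [ffun b => if free_box U b then None else Some (U b)].

Lemma key_free (U V : tableau) b : key U = key V -> free_box U b = free_box V b.
Proof.
by move/ffunP/(_ b); rewrite !ffunE; case: (free_box U b); case: (free_box V b).
Qed.

Lemma key_fixed (U V : tableau) b : key U = key V -> ~~ free_box V b -> U b = V b.
Proof.
move=> e nf; have ef := key_free b e; move/ffunP/(_ b): e.
by rewrite !ffunE ef (negPf nf) => -[].
Qed.

Lemma key_assign (T : tableau) sg : semistandard T -> key (assign j j' T sg) = key T.
Proof.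
move=> sT; apply/ffunP => b; rewrite !ffunE assign_free //.
by case: (free_box T b).
Qed.

Section OneClass.
Variable T : tableau.
Hypothesis sT : semistandard T.

Let fs := [seq b <- L | free_box T b].
Let cs := [seq height b | b <- fs].

Let unfree_word := \prod_(b <- L | ~~ free_box T b) gen q (box_letter T b).

Lemma comm_box (U : tableau) a b :
  skew_comm eps (comm_exp (box_letter U a) (box_letter U b))
    (gen q (box_letter U a)) (gen q (box_letter U b)).
Proof. exact: gen_comm. Qed.

(** Up to a power of [eps], the boxes that do not move can be read as boxes in
    other rows followed by dominoes, both of which [R] fixes. *)
Lemma unfree_word_fixed : 
  R unfree_word = unfree_word.
Proof.
pose top := domino_top j j' T; pose others := [seq b <- L | ~~ movable (T b)].
pose tops := [seq b <- L | top b].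
pose word := others ++ flatten [seq [:: b; partner j j' T b] | b <- tops].
have perm_word : perm_eq [seq b <- L | ~~ free_box T b] word.
  have L_uniq : uniq L by apply: reading_order_uniq.
  have inL b : b \in L by apply: mem_reading_order.
  have flat (l : seq D) :
    perm_eq (flatten [seq [:: b; partner j j' T b] | b <- l]) (l ++ map (partner j j' T) l).
    elim: l => //= b l ih; rewrite perm_cons perm_sym -[_ :: map _ l]cat1s.
    by rewrite perm_catCA /= perm_cons perm_sym.
  have perm_pairs := flat tops.
  apply: (@perm_trans _ (others ++ (tops ++ map (partner j j' T) tops))); last first.
    by rewrite perm_cat2l perm_sym.
  have part_inj : injective (partner j j' T) := inv_inj (partnerK jj' T).
  apply: uniq_perm; first by rewrite filter_uniq.
    rewrite !cat_uniq !filter_uniq // map_inj_uniq ?filter_uniq // andbT /=.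
    apply/andP; split.
      apply/hasPn => b; rewrite mem_cat !mem_filter => /orP[/andP[/domino_topP[-> _] _]|].
        by rewrite /movable eqxx.
      case/mapP=> c; rewrite mem_filter => /andP[tc _] ->.
      by have [_ ->] := top_partner tc; rewrite /movable eqxx orbT.
    apply/hasPn => b /mapP[c]; rewrite mem_filter => /andP[tc _] ->.
    have [_ e] := top_partner tc.
    rewrite mem_filter inL andbT; apply/negP => /domino_topP[].
    by rewrite e => /(congr1 val) /=; lia.
  move=> b; rewrite !mem_cat !mem_filter inL !andbT.
  have -> : (b \in map (partner j j' T) tops) = domino_bottom j j' T b.
    apply/mapP/idP => [[c]|bb].
      by rewrite mem_filter => /andP[tc _] ->; apply: partner_top.
    exists (partner j j' T b); last by rewrite partnerK.
    by rewrite mem_filter inL andbT; apply: partner_bottom.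
  rewrite /free_box /top; case: (movable _) => //.
  by case: (domino_top _ _ _ _); case: (domino_bottom _ _ _ _).
rewrite /unfree_word -big_filter.
have [z ->] := prod_perm eps_unit eps_central (comm_box T) perm_word.
rewrite rmorphM (R_exp rel_q hR); congr (_ * _).
rewrite big_cat rmorphM; congr (_ * _).
  rewrite rmorph_prod big_seq [RHS]big_seq; apply: eq_bigr => b.
  rewrite mem_filter negb_or => /andP[/andP[n1 n2] _].
  exact: (R_other hR).
rewrite big_flatten big_map rmorph_prod big_seq [RHS]big_seq; apply: eq_bigr => b.
rewrite mem_filter => /andP[tb _]; rewrite !big_cons !big_nil /= mulr1.
rewrite (letter_top r tb) (letter_partner hn r tb).
exact: (R_domino hn rel_q jj' division hR).
Qed.

Lemma before_partner a b : free_box T a -> ~~ free_box T b ->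
  before a (partner j j' T b) = before a b.
Proof.
move=> fa nfb.
have shift c d : below (val c) (val d) -> movable (T c) -> ~~ free_box T c ->
    before a d = before a c.
  move=> cd mc nfc; have ac : a != c by apply: contraNneq nfc => <-.
  have := free_column hs cD jj' x0 sT fa mc ac.
  have dE : rep_in x0 (val d) = ((rep_in x0 (val c)).1, (rep_in x0 (val c)).2 - 1).
    move: cd; rewrite -{1}(box_rep x0 (val c)) => /below_box ->.
    by rewrite rep_box // rep_bounds.
  rewrite /before /reads_before dE.
  by move: (rep_in _ _) (rep_in _ _) => u v /=; lia.
case tb: (domino_top j j' T b).
  have [bc _] := top_partner tb; apply: shift bc _ nfb.
  by case/domino_topP: tb => -> _; rewrite /movable eqxx.
case bb: (domino_bottom j j' T b); last by rewrite partner_single.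
have [bc Tc] := bottom_partner jj' bb; rewrite -(shift _ _ bc) //.
  by rewrite Tc /movable eqxx.
by rewrite not_free_partner.
Qed.

Definition misplaced (U : tableau) : int :=
  \sum_(a <- L | free_box T a) \sum_(b <- L | ~~ free_box T b && before a b)
     comm_exp (box_letter U a) (box_letter U b).

(** The two halves of a domino are read before or after a free box together, so
    that the exponents cancel out in pairs when the entry of the free box
    changes. *)
Lemma misplaced_letter a l : free_box T a -> movable l ->
  \sum_(b <- L | ~~ free_box T b && before a b)
     comm_exp (l, content (val a) + r) (box_letter T b) =
  \sum_(b <- L | ~~ free_box T b && before a b)
     comm_exp (j, content (val a) + r) (box_letter T b).
Proof.
move=> fa ml; apply/eqP; rewrite -subr_eq0 -sumrB.
set S := \sum_(b <- L | _) _; suff : S = - S by lia.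
have perm_L : perm_eq L (map (partner j j' T) L).
  have L_uniq : uniq L by apply: reading_order_uniq.
  have part_inj := inv_inj (partnerK jj' T).
  apply: uniq_perm; rewrite ?map_inj_uniq // => b.
  by rewrite -{2}(partnerK jj' T b) mem_map // !mem_reading_order.
rewrite {1}/S (perm_big _ perm_L) big_map /S -sumrN.
rewrite big_mkcond [RHS]big_mkcond; apply: eq_bigr => b _.
rewrite not_free_partner //; case: (boolP (free_box T b)) => //= nfb.
rewrite before_partner //; case: before => //.
by rewrite [in RHS](partner_comm_exp jj' hn r _ ml nfb) opprK.
Qed.

Lemma misplaced_class (U : tableau) : key U = key T -> misplaced U = misplaced T.
Proof.
move=> e; apply: eq_bigr => a fa.
transitivity (\sum_(b <- L | ~~ free_box T b && before a b)
    comm_exp (U a, content (val a) + r) (box_letter T b)).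
  apply: eq_bigr => b /andP[nfb _].
  by congr (comm_exp _ (_, _)); apply: key_fixed e nfb.
have mU : movable (U a) by apply: free_movable; rewrite (key_free _ e).
by rewrite (misplaced_letter fa mU) (misplaced_letter fa (free_movable fa)).
Qed.

Definition bits (U : tableau) : bitseq := [seq U b == j' | b <- fs].

(** Along a class only the last factor varies. *)
Lemma class_word (U : tableau) : key U = key T ->
  reading_word q x0 r U =
  eps ^ misplaced T * (unfree_word *
                       chain_word Y (zip cs (bits U))).
Proof.
move=> e; rewrite reading_wordE.
rewrite (prod_split eps_unit eps_central (free_box T) (comm_box U)
          (@reading_order_pairwise _ _ D x0)).
rewrite -/(misplaced U) misplaced_class //; congr (_ * (_ * _)).
  by apply: eq_bigr => b nfb; rewrite /box_letter (key_fixed e nfb).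
rewrite -big_filter /chain_word /bits zip_map big_map /= big_seq [RHS]big_seq.
apply: eq_bigr => b; rewrite mem_filter => /andP[fb _].
rewrite /Y /box_letter -/(height b) (content_lifted x0 hn); congr (gen q (_, _)).
have : movable (U b) by apply: free_movable; rewrite (key_free _ e).
by rewrite /movable; case: eqVneq => [->|_ /eqP->]; case: eqP.
Qed.

Lemma fs_free b : (b \in fs) = free_box T b.
Proof. by rewrite mem_filter mem_reading_order andbT. Qed.

Lemma fs_pairwise : pairwise lt fs.
Proof. by apply: pairwise_filter; apply: reading_order_pairwise. Qed.

Lemma lt_asym a b : lt a b -> ~~ lt b a.
Proof. by rewrite /lt => /andP[-> /negPf ->]. Qed.

Lemma bits_ok (U : tableau) : semistandard U -> key U = key T ->
  pairwise (chain_ok n) (zip cs (bits U)).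
Proof.
move=> sU e; rewrite /bits zip_map pairwise_map.
apply: (sub_in_pairwise (P := free_box T) _ _ fs_pairwise); last first.
  by apply/allP => b; rewrite fs_free.
move=> a b fa fb ab /=; apply/(free_chain_ok hs cD jj' sT _ _ fa fb ab).
have mono c d : free_box T c -> free_box T d -> right_of (val c) (val d) ->
    U c == j' -> U d == j'.
  move=> fc fd cd /eqP Uc; have := (sU c d).1 cd.
  have : movable (U d) by apply: free_movable; rewrite (key_free _ e).
  by rewrite Uc movableE // -val_eqE /=; lia.
by split; apply: mono.
Qed.

Lemma bits_onto (bs : bitseq) : size bs = size fs ->
  pairwise (chain_ok n) (zip cs bs) ->
  exists U, [/\ semistandard U, key U = key T & bits U = bs].
Proof.
move=> sz ok; pose sg b := nth false bs (index b fs).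
have fs_uniq : uniq fs by rewrite filter_uniq // reading_order_uniq.
have bsE : bs = [seq sg b | b <- fs].
  apply: (@eq_from_nth _ false) => [|i i_lt]; first by rewrite size_map.
  have b0 : D by case: fs sz => [|b *]; [case: (bs) i_lt|exact: b].
  by rewrite (nth_map b0) -?sz // /sg index_uniq -?sz.
exists (assign j j' T sg); split; last 1 first.
- rewrite /bits bsE; apply/eq_in_map => b; rewrite fs_free => fb.
  by rewrite ffunE fb; case: (sg b); rewrite ?eqxx // -val_eqE /= jj'; lia.
- apply: (assign_semistandard cD jj' sT) => a b fa fb ab.
  move: ok; rewrite bsE zip_map pairwise_map => ok.
  have rl := pairwise_ordered lt_asym fs_pairwise ok.
  have ne : a != b.
    apply/eqP => e; move: ab; rewrite e -{1}(box_repr (val b)) => /right_of_box.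
    rewrite -{1}(box_repr (val b)) => /boxP[t [h1 h2]].
    have : t = 0 by nia.
    by move=> t0; move: h1; rewrite t0; lia.
  have [ab_lt|] := boolP (lt a b).
    have := rl a b; rewrite !fs_free => /(_ fa fb ab_lt) /=.
    by move/(free_chain_ok hs cD jj' sT _ _ fa fb ab_lt) => [h _]; apply: h.
  have [ba_lt|nba nab] := boolP (lt b a).
    have := rl b a; rewrite !fs_free => /(_ fb fa ba_lt) /=.
    by move/(free_chain_ok hs cD jj' sT _ _ fb fa ba_lt) => [_ h] _; exact: h.
  case/eqP: ne; apply: (@before_anti _ _ D x0); move: nab nba (@before_total _ _ D x0 a b).
  by rewrite /lt /before; do 2!case: reads_before.
- exact: key_assign sT.
Qed.

Lemma bits_inj (U V : tableau) : key U = key T -> key V = key T ->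
  bits U = bits V -> U = V.
Proof.
move=> eU eV /eq_in_map UV; apply/ffunP => b.
have [fb|nfb] := boolP (free_box T b); last by rewrite (key_fixed eU) ?(key_fixed eV).
have := UV b; rewrite fs_free => /(_ fb).
have mU : movable (U b) by apply: free_movable; rewrite (key_free _ eU).
have mV : movable (V b) by apply: free_movable; rewrite (key_free _ eV).
move: mU mV; rewrite /movable.
by do 2![case: (eqVneq _ j') => [->|_]]; rewrite ?orbF // => /eqP-> /eqP->.
Qed.

Lemma class_sum :
  \sum_(U : tableau | `[< semistandard U >] && (key U == key T))
     reading_word q x0 r U =
  eps ^ misplaced T * (unfree_word *
                       chain_sum Y (chain_ok n) cs).
Proof.
rewrite (eq_bigr (fun U => eps ^ misplaced T *
  (unfree_word * chain_word Y (zip cs (bits U))))); last first.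
  by move=> U /andP[_ /eqP]; apply: class_word.
rewrite -!mulr_sumr; congr (_ * (_ * _)).
set P := fun U => _; rewrite -[LHS]big_filter /chain_sum -[RHS]big_filter.
rewrite -(big_map bits xpredT (fun bs => chain_word Y (zip cs bs))).
apply: perm_big; apply: uniq_perm.
- rewrite map_inj_in_uniq ?filter_uniq ?index_enum_uniq // => U V.
  rewrite !mem_filter => /andP[/andP[_ /eqP eU] _] /andP[/andP[_ /eqP eV] _].
  exact: bits_inj.
- by rewrite filter_uniq ?uniq_bitseqs.
move=> bs; rewrite mem_filter mem_bitseqs size_map; apply/mapP/andP.
  case=> U; rewrite mem_filter => /andP[/andP[/asboolP sU /eqP eU] _] ->.
  by rewrite bits_ok // size_map.
case=> ok /eqP sz; have [U [sU eU bE]] := bits_onto sz ok.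
by exists U; rewrite // mem_filter mem_index_enum andbT /P asboolT // eU eqxx.
Qed.

Lemma class_sum_fixed :
  let S := \sum_(U : tableau | `[< semistandard U >] && (key U == key T))
             reading_word q x0 r U in
  R S = S.
Proof.
rewrite /= class_sum !rmorphM (R_exp rel_q hR) unfree_word_fixed chain_fixed //.
  rewrite pairwise_map; apply: (sub_in_pairwise (P := free_box T) _ _ fs_pairwise).
    by move=> a b fa fb ab; case/andP: (free_contents hs cD jj' sT fa fb ab).
  by apply/allP => b; rewrite fs_free.
move=> x y /mapP[a + ->] /mapP[b + ->]; rewrite !fs_free => fa fb.
have [ab|nab] := boolP (lt a b).
  by have := free_contents hs cD jj' sT fa fb ab; rewrite -!/(height _); lia.
have [ba|nba] := boolP (lt b a).
  by have := free_contents hs cD jj' sT fb fa ba; rewrite -!/(height _); lia.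
have -> : a = b.
  apply: (@before_anti _ _ D x0); move: nab nba (@before_total _ _ D x0 a b).
  by rewrite /lt /before; do 2!case: reads_before.
by rewrite subrr; lia.
Qed.
End OneClass.

Lemma loop_schur_fixed : R (loop_schur D q x0 r) = loop_schur D q x0 r.
Proof.
rewrite /loop_schur (partition_big key predT) //= rmorph_sum.
apply: eq_bigr => k _.
have [T /andP[/asboolP sT /eqP <-]|none] :=
  pickP (fun U : tableau => `[< semistandard U >] && (key U == k)).
  exact: class_sum_fixed.
by rewrite big_pred0 // rmorph0.
Qed.
End Invariance.

(** * Invariance under the symmetric group *)

Lemma fractions_relations (m n : nat) (A Q : unitRingType) (eps : A)
    (q : 'I_m -> 'Z_n -> A) (iota : {rmorphism A -> Q}) :
  torus_relations eps q -> is_skew_field_of_fractions iota ->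
  torus_relations (iota eps) (fun k i => iota (q k i)).
Proof.
move=> rel_q frac.
have eps_unit := tr_eps_unit rel_q.
split.
- exact: rmorph_unit.
- move=> x; have [a [b [b0 ->]]] := sf_fraction frac x.
  have c y : GRing.comm (iota eps) (iota y).
    by rewrite /GRing.comm -!rmorphM (tr_eps_central rel_q).
  by apply: commrM => //; apply: commrV.
- by move=> j i; apply: rmorph_unit; apply: (tr_q_unit rel_q).
- by move=> k j i j' i' h h' le; rewrite -!rmorphM (tr_succ_le rel_q h h').
- move=> k j i j' i' h h' lt.
  by rewrite -rmorphV // -!rmorphM (tr_succ_gt rel_q h h').
- move=> k j i j' i' h h' lt.
  by rewrite -rmorphXn -rmorphV ?unitrX // -!rmorphM (tr_same_lt rel_q h h').
- move=> k j i j' i' h h' lt.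
  by rewrite -rmorphXn -!rmorphM (tr_same_gt rel_q h h').
- by move=> j i j' i' h h'; rewrite -!rmorphM (tr_comm rel_q h h').
Qed.

Theorem theorem6p11 (n m s : nat) (hn : (2 < n)%N) (hm : (2 <= m)%N)
    (hs : (1 <= s <= n.-1)%N)
    (A Q : unitRingType) (epsA : A) (qA : 'I_m -> 'Z_n -> A)
    (hA : is_quantum_torus epsA qA)
    (iota : {rmorphism A -> Q}) (hQ : is_skew_field_of_fractions iota)
    (R : 'I_m.-1 -> {rmorphism Q -> Q})
    (hR : forall (l : 'I_m.-1) (j j' : 'I_m),
        j = l :> nat -> j' = l.+1 :> nat ->
        is_R_matrix (iota epsA) (fun k i => iota (qA k i)) j j' (R l))
    (D : {fset cyl n s}) (hD : cylindric_skew_shape D)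
    (x0 : int) (r : 'Z_n) :
  fixed_by_all R (loop_schur D (fun k i => iota (qA k i)) x0 r).
Proof.
move=> l.
have lt_l : (l < m)%N by have := ltn_ord l; lia.
have lt_l' : (l.+1 < m)%N by have := ltn_ord l; lia.
exact: (loop_schur_fixed hn hs hD (j := Ordinal lt_l) (j' := Ordinal lt_l') erefl x0 r
          (fractions_relations (qt_relations hA) hQ) (sf_division hQ)
          (hR l (Ordinal lt_l) (Ordinal lt_l') erefl erefl)).
Qed.
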